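(* For $\mathcal{P}\in\Pi$, the following are equivalent: (1) $\mathcal{P}\in\mathrm{Fix}(\Pi)$; (2) $t\mathcal{P}=\mathcal{P}$ for some $t\in\mathbb{R}_+$ with $t\neq1$; (3) for all $N\ge1$ and all $\kappa_0,\dots,\kappa_N>0$ with $\sum_{i=0}^N\kappa_i<1$, $\mathrm{Sep}(\mathcal{P};\kappa_0,\dots,\kappa_N)$ is either $0$ or $+\infty$; (4) there exists $A\in\mathcal{A}$ with $\mathcal{P}=\mathcal{P}_A$.
   Context: mm-spaces are triples $(X,d_X,\mu_X)$ with $(X,d_X)$ complete separable metric and $\mu_X$ a Borel probability measure, with $X=\operatorname{supp}\mu_X$. $\mathcal{X}$ is the set of their isomorphism classes under measure-preserving isometries. $\square$ is the box distance on $\mathcal{X}$: $\square(X,Y)$ is the infimum of $\varepsilon\ge0$ such that there exist Borel maps $\varphi,\psi$ from $[0,1)$ pushing Lebesgue measure to $\mu_X,\mu_Y$ and a Borel set $I_0$ of measure $\ge1-\varepsilon$ with $|d_X(\varphi(s),\varphi(t))-d_Y(\psi(s),\psi(t))|\le\varepsilon$ on $I_0$. $Y\prec X$ means there is a 1-Lipschitz $f\colon X\to Y$ with $f_*\mu_X=\mu_Y$. A pyramid is a nonempty $\square$-closed subset of $\mathcal{X}$ that is downward closed under $\prec$ and such that any two elements are dominated by a common element. $\Pi$ is the set of pyramids. $\mathbb{R}_+=(0,\infty)$ acts on $\Pi$ by $t\mathcal{P}=\{(X,t\,d_X,\mu_X):X\in\mathcal{P}\}$, and $\mathrm{Fix}(\Pi)$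 is the set of fixed points. Separation distance: for an mm-space $X$ and $\kappa_0,\dots,\kappa_N>0$, $\mathrm{Sep}(X;\kappa_0,\dots,\kappa_N)$ is the supremum of $\min_{i\ne j}d_X(A_i,A_j)$ over Borel sets $A_0,\dots,A_N\subset X$ with $\mu_X(A_i)\ge\kappa_i$ for all $i$. It is defined to be $0$ if some $\kappa_i>1$. For a pyramid, $\mathrm{Sep}(\mathcal{P};\kappa_0,\dots,\kappa_N)=\lim_{\delta\to0+}\sup_{X\in\mathcal{P}}\mathrm{Sep}(X;\kappa_0-\delta,\dots,\kappa_N-\delta)\in[0,+\infty]$. $\mathcal{A}$ is the set of monotone non-increasing sequences $A=\{a_i\}_{i\ge1}$ of nonnegative reals with $\sum a_i\le1$. For $A\in\mathcal{A}$, $\mathcal{P}_A=\{X\in\mathcal{X}:\exists\{x_i\}_{i\ge1}\subset X\text{ with }\sum_i a_i\delta_{x_i}\le\mu_X\}$. *)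

(* Defs.v *)
From HB Require Import structures.
From mathcomp Require Import all_boot all_order all_algebra.
From mathcomp Require Import all_classical all_reals all_analysis.
Set Implicit Arguments. Unset Strict Implicit. Unset Printing Implicit Defensive.
Import Order.TTheory GRing.Theory Num.Theory.
Import numFieldNormedType.Exports.
Local Open Scope classical_set_scope.
Local Open Scope ring_scope.

Section MMSpaces.
Variable R : realType.

Definition is_metric (T : Type) (d : T -> T -> R) :=
  [/\ forall x y, 0 <= d x y,
      forall x y, d x y = 0 <-> x = y,
      forall x y, d x y = d y x &
      forall x y z, d x z <= d x y + d y z].

Definition mball (T : Type) (d : T -> T -> R) (x : T) (r : R) : set T :=
  [set y | d x y < r].

Definition mopen (T : Type) (d : T -> T -> R) (U : set T) :=
  forall x, U x -> exists2 r, 0 < r & mball d x r `<=` U.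

Definition mborel (T : Type) (d : T -> T -> R) (A : set T) :=
  forall S : set (set T),
    (forall U, mopen d U -> S U) ->
    (forall U, S U -> S (~` U)) ->
    (forall F : nat -> set T, (forall n, S (F n)) -> S (\bigcup_n F n)) ->
    S A.

Definition mcomplete (T : Type) (d : T -> T -> R) :=
  forall u : nat -> T,
    (forall e, 0 < e -> exists N, forall m n, (N <= m)%N -> (N <= n)%N ->
        d (u m) (u n) < e) ->
    exists l, forall e, 0 < e -> exists N, forall n, (N <= n)%N -> d (u n) l < e.

Definition mseparable (T : Type) (d : T -> T -> R) :=
  exists s : nat -> T, forall x e, 0 < e -> exists n, d x (s n) < e.

(* Borel probability measure (values on non-Borel sets are irrelevant) *)
Definition borel_prob (T : Type) (d : T -> T -> R) (mu : set T -> R) :=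
  [/\ forall A, mborel d A -> 0 <= mu A,
      mu setT = 1 &
      forall F : nat -> set T, (forall n, mborel d (F n)) ->
        trivIset setT F ->
        (fun n => \sum_(i < n) mu (F i)) @ \oo --> mu (\bigcup_n F n)].

Record mmspace := MMSpace {
  mpt :> Type;
  mdist : mpt -> mpt -> R;
  mmeas : set mpt -> R;
  mdist_metric : is_metric mdist;
  mdist_complete : mcomplete mdist;
  mdist_separable : mseparable mdist;
  mmeas_prob : borel_prob mdist mmeas;
  mmeas_full_support : forall x r, 0 < r -> 0 < mmeas (mball mdist x r)
}.

Definition borel (X : mmspace) := mborel (@mdist X).

Definition dominated (Y X : mmspace) :=
  exists f : X -> Y,
    (forall x x', mdist (f x) (f x') <= mdist x x') /\
    (forall B, borel B -> mmeas (f @^-1` B) = mmeas B).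

Definition I01 : set R := `[0, 1[%classic.

Definition leb (A : set R) : \bar R := @lebesgue_measure R A.

Definition Rborel (A : set R) := @measurable _ (measurableTypeR R) A.

Definition parameter (X : mmspace) (phi : R -> X) :=
  (forall B, borel B -> Rborel (I01 `&` phi @^-1` B)) /\
  (forall B, borel B -> leb (I01 `&` phi @^-1` B) = (mmeas B)%:E).

Definition box_ok (X Y : mmspace) (e : R) :=
  exists (phi : R -> X) (psi : R -> Y) (I0 : set R),
    [/\ parameter phi, parameter psi, Rborel I0 /\ I0 `<=` I01,
        ((1 - e)%:E <= leb I0)%E &
        forall s t, I0 s -> I0 t ->
          `|mdist (phi s) (phi t) - mdist (psi s) (psi t)| <= e].

Definition box (X Y : mmspace) : R := inf [set e | 0 <= e /\ box_ok X Y e].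

Definition pyramid (P : set mmspace) :=
  [/\ exists X, P X,
      (forall (Xs : nat -> mmspace) (X : mmspace), (forall n, P (Xs n)) ->
         box (Xs n) X @[n --> \oo] --> 0 -> P X),
      (forall X Y, P X -> dominated Y X -> P Y) &
      (forall X Y, P X -> P Y -> exists2 Z, P Z & dominated X Z /\ dominated Y Z)].

Definition scaled_iso (t : R) (X Y : mmspace) :=
  exists f : X -> Y, bijective f /\
    (forall x x', mdist (f x) (f x') = t * mdist x x') /\
    (forall B, borel B -> mmeas (f @^-1` B) = mmeas B).

(* t P = { (X, t d_X, mu_X) : X in P } (as isomorphism classes) *)
Definition scale_pyr (t : R) (P : set mmspace) : set mmspace :=
  [set Y | exists2 X, P X & scaled_iso t X Y].

Definition fixed_pyr (P : set mmspace) := forall t, 0 < t -> scale_pyr t P = P.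

Local Open Scope ereal_scope.

Definition set_dist (X : mmspace) (A B : set X) : \bar R :=
  ereal_inf [set (mdist a b)%:E | a in A & b in B].

Definition Sep_mm (X : mmspace) (N : nat) (kappa : 'I_N.+1 -> R) : \bar R :=
  if `[< exists i, (1 < kappa i)%R >] then 0%:E
  else ereal_sup [set ereal_inf [set s | exists i j, i != j /\ s = set_dist (A i) (A j)]
                 | A in [set A : 'I_N.+1 -> set X |
                          forall i, borel (A i) /\ (kappa i <= mmeas (A i))%R]].

Definition Sep_pyr_delta (P : set mmspace) (N : nat) (kappa : 'I_N.+1 -> R) (delta : R) : \bar R :=
  ereal_sup [set Sep_mm X (fun i => kappa i - delta)%R | X in P].

Definition Sep_pyr (P : set mmspace) (N : nat) (kappa : 'I_N.+1 -> R) : \bar R :=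
  lim (Sep_pyr_delta P kappa delta @[delta --> (0:R)^'+]).

Local Close Scope ereal_scope.

Definition seqA (a : nat -> R) :=
  [/\ forall i, 0 <= a i, forall i, a i.+1 <= a i &
      ((\sum_(i <oo) (a i)%:E) <= 1)%E].

Definition PA (a : nat -> R) : set mmspace :=
  [set X | exists x : nat -> mpt X,
     forall B, borel B ->
       ((\sum_(i <oo) (a i * \1_B (x i))%:E) <= (mmeas B)%:E)%E].

End MMSpaces.

(* Main.v *)
Require Import Defs.
From HB Require Import structures.
From mathcomp Require Import all_boot all_order all_algebra.
From mathcomp Require Import all_classical all_reals all_analysis.
From mathcomp Require Import ring lra.
Import Defs.
Set Implicit Arguments. Unset Strict Implicit. Unset Printing Implicit Defensive.
Import Order.TTheory GRing.Theory Num.Theory.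
Import numFieldNormedType.Exports.
Local Open Scope classical_set_scope.
Local Open Scope ring_scope.

(* (1) => (2) is trivial.  If tP = P then Sep(P) = t Sep(P), whence (3), and P_A
   is visibly scale invariant, whence (4) => (1).

   (3) => (4).  Let s_k be the infimum over X in P of the mass of the k heaviest
   atoms of X, and a_k = s_k - s_(k-1).  Domination merges atoms, so these masses
   decrease along P, and directedness yields, above any X in P, spaces Z in P
   whose heaviest atoms have masses close to a_1, ..., a_K.  Pushing these atoms
   to X and passing to the limit gives points of X witnessing X in P_A.

   Conversely P is closed, so it is enough to treat a finite F in P_A, with
   points s_i of mass b_i.  Take Z in P as above.  Its K heaviest atoms can be
   distributed among the s_i as prescribed by F in P_A, and the rest of Z can be
   cut into tiny pieces, which are distributed greedily; this yields separated
   subsets of Z of masses almost b_i.  Hence Sep(P; b_i - eps) is positive, so it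
   is infinite by (3): some Y in P has subsets of masses almost b_i which are
   farther apart than the diameter of F.  A 1-Lipschitz map collapses these
   subsets to a copy of F, and its image is box-close to F. *)

(** * Borel sets and Borel probability measures *)

Section Borel.
Variables (R : realType) (T : Type) (d : T -> T -> R).

Lemma mborel_open U : mopen d U -> mborel d U.
Proof. by move=> oU S hO _ _; exact: hO. Qed.

Lemma mborelC A : mborel d A -> mborel d (~` A).
Proof. by move=> bA S hO hC hU; apply: (hC); exact: bA. Qed.

Lemma mborel_bigcup (F : nat -> set T) :
  (forall n, mborel d (F n)) -> mborel d (\bigcup_n F n).
Proof. by move=> bF S hO hC hU; apply: (hU) => n; exact: bF. Qed.

Lemma mborelT : mborel d setT.
Proof. by apply: mborel_open => x _; exists 1. Qed.

Lemma mborel0 : mborel d set0.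
Proof. by rewrite -setCT; apply: mborelC; exact: mborelT. Qed.

Lemma mborelU A B : mborel d A -> mborel d B -> mborel d (A `|` B).
Proof.
move=> bA bB; rewrite -bigcup2E; apply: mborel_bigcup => -[|[|n]] //=.
exact: mborel0.
Qed.

Lemma mborelI A B : mborel d A -> mborel d B -> mborel d (A `&` B).
Proof.
by move=> bA bB; rewrite -(setCK (A `&` B)) setCI;
  apply: mborelC; apply: mborelU; exact: mborelC.
Qed.

Lemma mborelD A B : mborel d A -> mborel d B -> mborel d (A `\` B).
Proof. by move=> bA bB; rewrite setDE; apply: mborelI => //; exact: mborelC. Qed.

Lemma mborel_const (Q : Prop) : mborel d [set _ | Q].
Proof.
have [q|q] := pselect Q.
  by rewrite (_ : [set _ | Q] = setT); [exact: mborelT|apply/seteqP; split].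
by rewrite (_ : [set _ | Q] = set0); [exact: mborel0|apply/seteqP; split].
Qed.

End Borel.

Section BorelMaps.
Variables (R : realType) (T : Type) (d : T -> T -> R).

(** The sets with Borel preimage form a class closed under complements and countable unions that
    contains the open sets. The impredicative [mborel] is applied to this class. *)
Lemma mborel_preimage (T' : Type) (d' : T' -> T' -> R) (f : T' -> T) :
  (forall U, mopen d U -> mborel d' (f @^-1` U)) ->
  forall B, mborel d B -> mborel d' (f @^-1` B).
Proof.
move=> fo B bB; refine (bB (fun B => mborel d' (f @^-1` B)) fo _ _).
- by move=> U; exact: mborelC.
- by move=> F bF; rewrite preimage_bigcup; exact: mborel_bigcup.
Qed.

Lemma mborel_lipschitz (T' : Type) (d' : T' -> T' -> R) (f : T' -> T) (t : R) :
  0 < t -> (forall x x', d (f x) (f x') <= t * d' x x') ->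
  forall B, mborel d B -> mborel d' (f @^-1` B).
Proof.
move=> t0 flip; apply: mborel_preimage => U oU; apply: mborel_open => x Ux.
have [r r0 rU] := oU _ Ux; exists (r / t); first by rewrite divr_gt0.
move=> y /= xy; apply: rU; apply: (le_lt_trans (flip _ _)).
by rewrite mulrC -ltr_pdivlMr.
Qed.

Hypothesis dm : is_metric d.

Lemma mopen_ball x r : mopen d (mball d x r).
Proof.
move=> y xy; exists (r - d x y); first by rewrite subr_gt0.
case: dm => _ _ _ tri z yz.
by apply: (le_lt_trans (tri _ y _)); rewrite /mball /= in yz; rewrite addrC -ltrBrDr.
Qed.

Lemma mopen_gt x r : mopen d [set y | r < d x y].
Proof.
move=> y /= xy; exists (d x y - r); first by rewrite subr_gt0.
case: dm => _ _ sym tri z; rewrite /mball /= => yz.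
by have := tri x z y; rewrite (sym z y); lra.
Qed.

Lemma mborel_le x r : mborel d [set y | d x y <= r].
Proof.
rewrite (_ : [set _ | _] = ~` [set y | r < d x y]).
  by apply: mborelC; apply: mborel_open; exact: mopen_gt.
by apply/seteqP; split=> y /=; [rewrite leNgt => /negP|move=> /negP; rewrite -leNgt].
Qed.

Lemma mborel1 x : mborel d [set x].
Proof.
rewrite (_ : [set x] = [set y | d x y <= 0]); first exact: mborel_le.
case: dm => d0 dx _ _; apply/seteqP; split=> y /=.
  by move=> ->; rewrite ((dx x x).2 erefl).
by move=> h; symmetry; apply/dx/eqP; rewrite eq_le h d0.
Qed.

End BorelMaps.

(** * Elementary properties of the measure of an mm-space *)

Section Measure.
Variables (R : realType) (X : mmspace R).
Implicit Types A B : set X.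
Local Notation d := (@mdist R X).

Lemma dist_ge0 (x y : X) : 0 <= mdist x y.
Proof. by case: (mdist_metric X). Qed.

Lemma dist_eq0 (x y : X) : mdist x y = 0 <-> x = y.
Proof. by case: (mdist_metric X). Qed.

Lemma distxx (x : X) : mdist x x = 0.
Proof. exact/dist_eq0. Qed.

Lemma mdistC (x y : X) : mdist x y = mdist y x.
Proof. by case: (mdist_metric X). Qed.

Lemma dist_tri (y x z : X) : mdist x z <= mdist x y + mdist y z.
Proof. by case: (mdist_metric X). Qed.

Lemma borel_ball (x : X) r : borel (mball d x r).
Proof. by apply: mborel_open; apply: mopen_ball; exact: mdist_metric. Qed.

Lemma borel1 (x : X) : borel [set x].
Proof. by apply: mborel1; exact: mdist_metric. Qed.

Lemma mu_ge0 A : borel A -> 0 <= mmeas A.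
Proof. by case: (mmeas_prob X) => + _ _; exact. Qed.

Lemma muT : mmeas (@setT X) = 1.
Proof. by case: (mmeas_prob X). Qed.

(** Countable additivity on the constant sequence [set0] makes the multiples of [mmeas set0]
    converge to [mmeas set0]. They are nondecreasing, so twice the value is at most the value. *)
Lemma mu0 : mmeas (@set0 X) = 0.
Proof.
have [m0 _ mU] := mmeas_prob X.
apply/eqP; rewrite eq_le m0 ?andbT; last exact: mborel0.
have b0 := @mborel0 _ _ d.
have /= := mU (fun=> set0) (fun=> b0).
rewrite bigcup0 // => /(_ _) h.
have {}h : (fun n => \sum_(i < n) mmeas (@set0 X)) @ \oo --> mmeas (@set0 X).
  by apply: h; apply/trivIsetP => i j _ _ _; rewrite set0I.
have hl := cvg_lim (@Rhausdorff R) h.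
have nd : nondecreasing_seq (fun n => \sum_(i < n) mmeas (@set0 X)).
  apply/nondecreasing_seqP => n; rewrite big_ord_recr /= lerDl; exact: m0.
have := nondecreasing_cvgn_le nd (cvgP _ h) 2%N.
by rewrite hl !big_ord_recr big_ord0 /= add0r gerDl.
Qed.

Lemma muU A B : borel A -> borel B -> A `&` B = set0 ->
  mmeas (A `|` B) = mmeas A + mmeas B.
Proof.
move=> bA bB AB; have [m0 _ mU] := mmeas_prob X.
have b2 n : borel (bigcup2 A B n) by move: n => [|[|n]] //=; exact: mborel0.
have t2 : trivIset setT (bigcup2 A B).
  apply/trivIsetP => -[|[|i]] [|[|j]] //= _ _ _;
  by rewrite ?(set0I, setI0) // setIC.
have h1 := mU _ b2 t2; rewrite bigcup2E in h1.
have h2 : (fun n => \sum_(i < n) mmeas (bigcup2 A B i)) @ \oo --> mmeas A + mmeas B.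
  apply: cvg_near_cst; exists 2%N => //= -[|[|n]] //= _.
  by rewrite !big_ord_recl /= big1 ?addr0 // => i _; exact: mu0.
exact: (cvg_unique (@Rhausdorff R) h1 h2).
Qed.

Lemma mu_le A B : borel A -> borel B -> A `<=` B -> mmeas A <= mmeas B.
Proof.
move=> bA bB AB; have bBA := mborelD bB bA.
rewrite -(setDUK AB) muU ?lerDl ?mu_ge0 //.
by apply/seteqP; split=> x //= [? []].
Qed.

Lemma mu_le1 A : borel A -> mmeas A <= 1.
Proof. by move=> bA; rewrite -muT; apply: mu_le => //; exact: mborelT. Qed.

Lemma muC A : borel A -> mmeas (~` A) = 1 - mmeas A.
Proof.
move=> bA; rewrite -muT -(setUv A) muU ?setICr //; last exact: mborelC.
by rewrite addrAC subrr add0r.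
Qed.

Lemma mu_inclU A B C : borel A -> borel B -> borel C -> A `<=` B `|` C ->
  mmeas A <= mmeas B + mmeas C.
Proof.
move=> bA bB bC ABC; have bCB := mborelD bC bB.
have le1 : mmeas (C `\` B) <= mmeas C by apply: mu_le => // x [].
apply: le_trans (lerD (lexx _) le1); rewrite -muU //; last first.
  by apply/seteqP; split=> x //= [? []].
apply: mu_le => //; first exact: mborelU.
by move=> x /ABC [|]; [left|have [|] := pselect (B x); [left|right]].
Qed.

Lemma borel_bigcup_ord (F : nat -> set X) n : (forall i, borel (F i)) ->
  borel (\big[setU/set0]_(i < n) F i).
Proof.
move=> bF; elim: n => [|n IH]; first by rewrite big_ord0; exact: mborel0.
by rewrite big_ord_recr /=; apply: mborelU; [exact: IH|exact: bF].
Qed.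

Lemma mu_bigcup_ord (F : nat -> set X) n : (forall i, borel (F i)) ->
  trivIset setT F ->
  mmeas (\big[setU/set0]_(i < n) F i) = \sum_(i < n) mmeas (F i).
Proof.
move=> bF /trivIsetP tF; elim: n => [|n IH]; first by rewrite !big_ord0 mu0.
rewrite !big_ord_recr /= muU ?IH //; first exact: borel_bigcup_ord.
apply/seteqP; split=> x // []; rewrite -bigcup_mkord => -[i /= ltin Fi] Fn.
suff : (F i `&` F n) x by rewrite tF ?neq_ltn ?ltin.
by split.
Qed.

(** Continuity from below, obtained by applying countable additivity to the disjoint increments
    [seqDU F]. *)
Lemma mu_bigcup_approx (F : nat -> set X) e : (forall i, borel (F i)) ->
  (forall n, F n `<=` F n.+1) -> 0 < e ->
  exists n, mmeas (\bigcup_n F n) - e < mmeas (F n).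
Proof.
move=> bF sF e0; have [m0 _ mU] := mmeas_prob X.
have FS m n : (m <= n)%N -> F m `<=` F n.
  move=> mn; rewrite -(subnKC mn); elim: (n - m)%N => [|k IH]; first by rewrite addn0.
  by rewrite addnS => x /IH; exact: sF.
have bD i : borel (seqDU F i).
  apply: mborelD => //; [exact: bF|exact: (borel_bigcup_ord _ bF)].
have /cvgrPdist_lt /(_ _ e0) [N _ /(_ N (leqnn N)) /=] :=
  mU _ bD (trivIset_seqDU F).
rewrite -seqDU_bigcup_eq -(mu_bigcup_ord _ bD (trivIset_seqDU F)).
rewrite ltr_distl => /andP[_ h].
exists N; rewrite ltrBlDr; apply: (lt_le_trans h); rewrite lerD2r.
apply: mu_le => //; first exact: (borel_bigcup_ord _ bD).
rewrite -bigcup_mkord => x [i /= iN [Fx _]].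
by apply: FS Fx; rewrite ltnW.
Qed.

(** The complements of the balls of radius [1 / (n + 1)] increase to the complement of the centre,
    so continuity from below applies. *)
Lemma mu_ball_approx (x : X) e : 0 < e ->
  exists2 r, 0 < r & mmeas (mball d x r) < mmeas [set x] + e.
Proof.
move=> e0; pose F n := ~` mball d x (n.+1%:R^-1).
have bF n : borel (F n) by apply: mborelC; exact: borel_ball.
have FS n : F n `<=` F n.+1.
  apply: subsetC => y; rewrite /mball /= => h; apply: (lt_le_trans h).
  by rewrite lef_pV2 ?posrE ?ltr0n // ler_nat.
have [n hn] := mu_bigcup_approx bF FS e0.
exists n.+1%:R^-1; first by rewrite invr_gt0 ltr0n.
have E : \bigcup_n F n = ~` [set x].
  apply/seteqP; split=> y /=.
    by move=> [m _ /= h] yx; apply: h; rewrite yx /mball /= distxx invr_gt0 ltr0n.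
  move=> yx; have dxy : 0 < mdist x y.
    rewrite lt_neqAle dist_ge0 andbT; apply/eqP => /esym/dist_eq0 xy.
    by apply: yx; rewrite xy.
  have [k hk] := ltr_add_invr dxy; rewrite add0r in hk.
  by exists k => //=; rewrite /mball /=; apply/negP; rewrite -leNgt ltW.
move: hn; rewrite E muC; last exact: borel1.
rewrite /F muC; [lra|exact: borel_ball].
Qed.

End Measure.

(** * Partitions into balls and atoms *)

Section Fibres.
Variables (R : realType) (X : mmspace R).
Implicit Types (g : X -> nat) (c : nat -> X) (r : nat -> R).
Local Notation d := (@mdist R X).

Lemma borel_fibre g (Q : nat -> Prop) :
  (forall n, borel (g @^-1` [set n])) -> borel [set x | Q (g x)].
Proof.
move=> bg; rewrite (_ : [set _ | _] = \bigcup_n ((g @^-1` [set n]) `&` [set _ | Q n])).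
  by apply: mborel_bigcup => n; apply: mborelI; [exact: bg|exact: mborel_const].
by apply/seteqP; split=> x /= => [Qx|[n _ [/= -> //]]]; exists (g x).
Qed.

Lemma mu_fibre g (Q : pred nat) M : (forall n, borel (g @^-1` [set n])) ->
  mmeas [set x | (g x < M)%N && Q (g x)] =
  \sum_(l < M | Q l) mmeas (g @^-1` [set (l : nat)]).
Proof.
move=> bg; pose F n := if Q n then g @^-1` [set n] else set0.
have bF n : borel (F n) by rewrite /F; case: ifP => // _; exact: mborel0.
have tF : trivIset setT F.
  apply/trivIsetP => i j _ _ ij; apply/seteqP; split=> x //; rewrite /F.
  by case: ifP => _; case: ifP => _ [] //= gi gj; move: ij; rewrite -gi -gj eqxx.
rewrite big_mkcond /= (_ : [set _ | _] = \big[setU/set0]_(i < M) F i); last first.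
  rewrite -bigcup_mkord; apply/seteqP; split=> x /=.
    by move=> /andP[xM Qx]; exists (g x) => //; rewrite /F Qx.
  by move=> [i /= iM]; rewrite /F; case: ifP => // Qi /= ->; rewrite iM.
rewrite (mu_bigcup_ord _ bF tF); apply: eq_bigr => i _.
by rewrite /F; case: ifP => // _; rewrite mu0.
Qed.

(** The value is [M] when none of the first [M] balls contains the point. The fibres thus partition
    the space into [M] successive differences of balls and one leftover cell. *)
Definition first_ball c r M (x : X) : nat :=
  find (fun l => mdist (c l) x < r l) (iota 0 M).

Lemma first_ball_le c r M x : (first_ball c r M x <= M)%N.
Proof. by rewrite /first_ball -[leqRHS](size_iota 0) find_size. Qed.

Lemma first_ball_lt c r M x (l := first_ball c r M x) :
  (l < M)%N -> mdist (c l) x < r l.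
Proof.
move=> lM; have := @nth_find _ 0%N (fun l => mdist (c l) x < r l) (iota 0 M).
by rewrite has_find size_iota nth_iota // => /(_ lM).
Qed.

Lemma first_ball_ge c r M x l :
  (l < first_ball c r M x)%N -> r l <= mdist (c l) x.
Proof.
move=> lg; have := before_find 0%N lg.
rewrite nth_iota ?add0n; last exact: leq_trans lg (first_ball_le _ _ _ _).
by move=> /negbT; rewrite -leNgt.
Qed.

Lemma borel_first_ball c r M n : borel (first_ball c r M @^-1` [set n]).
Proof.
rewrite /first_ball; elim: (iota 0 M) n => [|l s IH] n.
  exact: (@mborel_const _ _ d (0%N = n)).
rewrite (_ : _ @^-1` _ = (mball d (c l) (r l) `&` [set _ | 0%N = n]) `|`
   (~` mball d (c l) (r l) `&`
     [set x | (find (fun l => mdist (c l) x < r l) s).+1 = n])).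
  apply: mborelU; apply: mborelI.
  - exact: borel_ball.
  - exact: (@mborel_const _ _ d (0%N = n)).
  - by apply: mborelC; exact: borel_ball.
  - exact: (borel_fibre (fun k => k.+1 = n) IH).
apply/seteqP; rewrite /mball; split=> x /=; case: ifP => //.
- by move=> xl <-; left.
- by move=> xl <-; right; split => //; rewrite xl.
- by move=> xl [[_ <-]|[]].
- by move=> xl [[]|[]]; rewrite ?xl.
Qed.

End Fibres.

(** * Atoms listed by decreasing mass *)

Section Atoms.
Variables (R : realType) (X : mmspace R).
Local Notation mu1 x := (mmeas [set x]).

Lemma mmspace_inhabited : exists x : X, True.
Proof.
apply: contrapT => nX; suff : mmeas (@setT X) = mmeas (@set0 X).
  by rewrite muT mu0 => /eqP; rewrite oner_eq0.
by congr mmeas; apply/seteqP; split=> x // _; apply: nX; exists x.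
Qed.

(** Induction on [K], removing [u K] from [B]. Distinctness is asked only at positive weight, so
    that repeated junk points of weight 0 are allowed. *)
Lemma sum_atoms_le (v : nat -> R) (u : nat -> X) (K : nat) (B : set X) :
  borel B -> (forall k, 0 <= v k) -> (forall k, v k <= mu1 (u k)) ->
  (forall j k, (j < k)%N -> 0 < v k -> u j <> u k) ->
  \sum_(k < K) v k * \1_B (u k) <= mmeas B.
Proof.
move=> + v0 vu uu; elim: K B => [|K IH] B bB; first by rewrite big_ord0 mu_ge0.
rewrite big_ord_recr /=.
have [h|[h1 h2]] : v K * \1_B (u K) = 0 \/ (0 < v K /\ B (u K)).
  have [->|vK] := eqVneq (v K) 0; first by left; rewrite mul0r.
  have [BK|BK] := pselect (B (u K)); first by right; rewrite lt_neqAle eq_sym vK v0.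
  by left; rewrite indicE memNset // mulr0.
  by rewrite h addr0; exact: IH.
have bD : borel (B `\` [set u K]) by apply: mborelD => //; exact: borel1.
rewrite indicE mem_set // mulr1.
have -> : mmeas B = mmeas (B `\` [set u K]) + mu1 (u K).
  rewrite -muU //; [congr mmeas|exact: borel1|].
    by rewrite setUC setDUK // => x ->.
  by apply/seteqP; split=> x //= [[]].
apply: lerD => //; apply: le_trans (IH _ bD); apply: ler_sum => k _.
apply: ler_wpM2l => //; rewrite !indicE ler_nat.
case: (boolP (u k \in B)) => // /set_mem Bk; rewrite mem_set //.
by split => //; exact: uu.
Qed.

(** Without a heaviest atom outside [L], each atom there would have a strictly heavier successor.
    Iterating yields distinct atoms at least as heavy as [x0], whose total mass eventually exceeds
    1. *)
Lemma max_atom (L : set X) : (exists2 x, ~ L x & 0 < mu1 x) ->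
  exists x, [/\ ~ L x, 0 < mu1 x & forall y, ~ L y -> mu1 y <= mu1 x].
Proof.
move=> [x0 Lx0 x00]; apply: contrapT => nx.
have /choice [h hP] : forall x, exists y, ~ L x -> 0 < mu1 x -> ~ L y /\ mu1 x < mu1 y.
  move=> x; apply: contrapT => hx; apply: nx; exists x.
  have /not_implyP [Lx] : ~ (~ L x -> ~ 0 < mu1 x).
    by move=> h; apply: hx; exists x => /h.
  move=> /contrapT x1; split => // y Ly; rewrite leNgt; apply/negP => xy.
  by apply: hx; exists y.
pose u n := iter n h x0.
have uP n : ~ L (u n) /\ 0 < mu1 (u n).
  elim: n => [//|n [h1 h2]]; have [h3 h4] := hP _ h1 h2; split => //.
  exact: lt_trans h4.
have uS n : mu1 (u n) < mu1 (u n.+1) by have [? ?] := uP n; case: (hP (u n)).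
have ulem m n : (m <= n)%N -> mu1 (u m) <= mu1 (u n).
  move=> mn; rewrite -(subnKC mn); elim: (n - m)%N => [|k IH]; first by rewrite addn0.
  by rewrite addnS (le_trans IH) // ltW.
have [n hn] : exists n, 1 < n%:R * mu1 x0.
  exists (Num.bound (mu1 x0)^-1); rewrite -ltr_pdivrMr // div1r.
  by apply: archi_boundP; rewrite invr_ge0 ltW.
have := @sum_atoms_le (fun k => mu1 (u k)) u n setT (@mborelT _ _ _).
rewrite muT => /(_ _ _ _) h1; have {}h1 : \sum_(k < n) mu1 (u k) * \1_setT (u k) <= 1.
  apply: h1 => // [k|j k jk _ ujk]; first by apply: mu_ge0; exact: borel1.
  have := lt_le_trans (uS j) (ulem _ _ jk); by rewrite ujk ltxx.
move: hn; apply/negP; rewrite -leNgt; apply: le_trans h1.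
have -> : n%:R * mu1 x0 = \sum_(k < n) mu1 x0 by rewrite sumr_const card_ord mulr_natl.
by apply: ler_sum => k _; rewrite indicE in_setT mulr1 (ulem 0%N).
Qed.

Let best (L : set X) : X :=
  if pselect (exists2 x, ~ L x & 0 < mu1 x) is left h then sval (cid (max_atom h))
  else sval (cid mmspace_inhabited).

Fixpoint topset n : set X :=
  if n is m.+1 then topset m `|` [set best (topset m)] else set0.

(* The [n]-th heaviest atom; a junk point of weight [atomw n = 0] once the
   atoms are exhausted. *)
Definition atom n : X := best (topset n).

Definition atomw n : R :=
  if pselect (exists2 x, ~ topset n x & 0 < mu1 x) is left _ then mu1 (atom n)
  else 0.

Definition topw K : R := \sum_(k < K) atomw k.

Lemma atomw_ge0 n : 0 <= atomw n.
Proof. by rewrite /atomw; case: pselect => // _; apply: mu_ge0; exact: borel1. Qed.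

Lemma atomw_le n : atomw n <= mu1 (atom n).
Proof. by rewrite /atomw; case: pselect => // _; apply: mu_ge0; exact: borel1. Qed.

Lemma topsetP n x : topset n x <-> exists2 j, (j < n)%N & atom j = x.
Proof.
elim: n => [|n IH] /=; first by split => // -[].
split=> [[/IH [j jn <-]|->]|[j]].
- by exists j => //; rewrite ltnW.
- by exists n.
- by rewrite ltnS leq_eqVlt => /orP[/eqP ->|jn] h; [right|left; apply/IH; exists j].
Qed.

Lemma atomP n : 0 < atomw n -> ~ topset n (atom n).
Proof.
rewrite /atomw /atom /best; case: pselect => [h|]; last by rewrite ltxx.
by case: cid => x [].
Qed.

Lemma atom_neq j k : (j < k)%N -> 0 < atomw k -> atom j <> atom k.
Proof. by move=> jk /atomP h e; apply: h; apply/topsetP; exists j. Qed.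

Lemma atomw_max n x : ~ topset n x -> mu1 x <= atomw n.
Proof.
move=> nx; rewrite /atomw /atom /best; case: pselect => [h|h].
  by case: cid => y /= [_ _]; exact.
by rewrite leNgt; apply/negP => x0; apply: h; exists x.
Qed.

Lemma atomw_noninc n : atomw n.+1 <= atomw n.
Proof.
have [h|h] := ltP 0 (atomw n.+1); last exact: le_trans h (atomw_ge0 n).
apply: le_trans (atomw_le _) _; apply: atomw_max => h2.
by apply: (atomP h) => /=; left.
Qed.

Lemma atomw_sum_le K (B : set X) : borel B ->
  \sum_(k < K) atomw k * \1_B (atom k) <= mmeas B.
Proof.
move=> bB; apply: sum_atoms_le => //; [exact: atomw_ge0|exact: atomw_le|].
exact: atom_neq.
Qed.

Lemma topw_le1 K : topw K <= 1.
Proof.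
rewrite -(muT X) (le_trans _ (atomw_sum_le K (@mborelT _ _ _))) //.
by apply: ler_sum => k _; rewrite indicE in_setT mulr1.
Qed.

(** The first [n + 1] weights are all at least [atomw n], and they sum to at most 1. *)
Lemma atomw_small n : atomw n <= n.+1%:R^-1.
Proof.
have ale m k : (m <= k)%N -> atomw k <= atomw m.
  move=> mk; rewrite -(subnKC mk); elim: (k - m)%N => [|j IH]; first by rewrite addn0.
  by rewrite addnS (le_trans (atomw_noninc _)).
rewrite -div1r ler_pdivlMr ?ltr0n // (le_trans _ (topw_le1 n.+1)) //.
have -> : atomw n * n.+1%:R = \sum_(k < n.+1) atomw n by rewrite sumr_const card_ord mulr_natr.
by apply: ler_sum => k _; apply: ale; rewrite -ltnS.
Qed.

Lemma borel_range (u : nat -> X) K : borel [set x | exists2 j, (j < K)%N & u j = x].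
Proof.
rewrite (_ : [set _ | _] = \bigcup_j ([set u j] `&` [set _ | (j < K)%N])).
  by apply: mborel_bigcup => n; apply: mborelI; [exact: borel1|exact: mborel_const].
apply/seteqP; split=> x /= => [[j jK <-]|[j _ [/= -> jK]]]; first by exists j.
by exists j.
Qed.

Lemma mu_topset K : mmeas (topset K) <= topw K.
Proof.
have bt n : borel (topset n).
  elim: n => [|n IH]; [exact: mborel0|by apply: mborelU; [exact: IH|exact: borel1]].
rewrite /topw; elim: K => [|K IH]; first by rewrite big_ord0 mu0.
rewrite big_ord_recr /=; have [h|h] := pselect (topset K (atom K)).
  rewrite (_ : topset K `|` _ = topset K) ?ler_wpDr ?atomw_ge0 //.
  by apply/seteqP; split=> x; [case=> [//|->]|left].
apply: le_trans (mu_inclU (bt K.+1) (bt K) (borel1 (atom K)) _) _ => //.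
by apply: lerD => //; exact: atomw_max.
Qed.

(** Exchange argument. If some [u j] lies outside [topset K], its mass is at most [atomw K] and
    induction handles the other points. Otherwise all the points lie in [topset K]. *)
Lemma topw_max (u : nat -> X) K :
  mmeas [set x | exists2 j, (j < K)%N & u j = x] <= topw K.
Proof.
elim: K u => [|K IH] u.
  rewrite (_ : [set _ | _] = set0) ?mu0 ?/topw ?big_ord0 //.
  by apply/seteqP; split=> x // -[].
have [[j jK nj]|h] := pselect (exists2 j, (j < K.+1)%N & ~ topset K (u j)).
  (* The point [u j] is discarded by moving the last point [u K] into its slot. *)
  pose u' i := if i == j then u K else u i.
  rewrite /topw big_ord_recr /=; apply: le_trans (lerD (IH u') (atomw_max nj)).
  apply: mu_inclU; [exact: borel_range|exact: borel_range|exact: borel1|].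
  move=> x [i iK <-]; have [->|ij] := eqVneq i j; first by right.
  left => /=; move: iK; rewrite ltnS leq_eqVlt => /orP[/eqP iK|iK].
    exists j; last by rewrite /u' eqxx iK.
    by rewrite iK in ij; move: jK; rewrite ltnS leq_eqVlt eq_sym (negbTE ij).
  by exists i => //; rewrite /u' (negbTE ij).
have bt n : borel (topset n).
  elim: n => [|n IHn]; [exact: mborel0|by apply: mborelU; [exact: IHn|exact: borel1]].
apply: (@le_trans _ _ (topw K)); last first.
  by rewrite /topw big_ord_recr /= lerDl atomw_ge0.
apply: le_trans (mu_topset K); apply: mu_le => //; first exact: borel_range.
by move=> x [j jK <-]; apply: contrapT => nj; apply: h; exists j.
Qed.

End Atoms.

(** The images of the first [K] atoms of [Z] are at most [K] points of [X] which together carry at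
    least the mass of these atoms. *)
Lemma topw_dominated (R : realType) (X Z : mmspace R) K :
  dominated X Z -> topw Z K <= topw X K.
Proof.
move=> [f [fl fm]]; apply: le_trans (topw_max (fun k => f (atom Z k)) K).
set U := [set x | _]; have bU : borel U by exact: borel_range.
rewrite -fm //; have bfU : borel (f @^-1` U).
  by apply: (mborel_lipschitz (t := 1) _ _ bU) => // x x'; rewrite mul1r.
apply: le_trans (atomw_sum_le K bfU); apply: ler_sum => k _.
by rewrite indicE mem_set ?mulr1 //; exists k.
Qed.

(** * The weights attached to a pyramid *)

Section Domination.
Variable R : realType.
Implicit Types X Y Z : mmspace R.

Lemma borel_dominated X Y (f : X -> Y) (B : set Y) :
  (forall x x', mdist (f x) (f x') <= mdist x x') -> borel B -> borel (f @^-1` B).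
Proof.
move=> fl bB; apply: (mborel_lipschitz (t := 1) _ _ bB) => // x x'.
by rewrite mul1r.
Qed.

Lemma dominated_trans Y X Z : dominated X Y -> dominated Y Z -> dominated X Z.
Proof.
move=> [f [fl fm]] [g [gl gm]]; exists (f \o g); split=> [x x'|B bB].
  exact: le_trans (fl _ _) (gl _ _).
by rewrite -fm // -(gm (f @^-1` B)) //; exact: borel_dominated.
Qed.

Lemma dominated_refl X : dominated X X.
Proof. by exists id. Qed.

End Domination.

Lemma nneseries_le_partial (R : realType) (f : nat -> R) (M : R) :
  (forall i, 0 <= f i) -> (forall n, \sum_(i < n) f i <= M) ->
  (\sum_(i <oo) (f i)%:E <= M%:E)%E.
Proof.
move=> f0 fM; apply: lime_le.
  by apply: is_cvg_nneseries => n _ _; rewrite lee_fin.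
by apply: nearW => n; rewrite sumEFin lee_fin big_mkord.
Qed.

Lemma nneseries_ge_partial (R : realType) (f : nat -> R) (M : R) :
  (forall i, 0 <= f i) -> (\sum_(i <oo) (f i)%:E <= M%:E)%E ->
  forall n, \sum_(i < n) f i <= M.
Proof.
move=> f0 fM n; rewrite -lee_fin; apply: le_trans fM.
rewrite -(big_mkord xpredT f) -sumEFin.
by apply: nneseries_lim_ge => i _ _; rewrite lee_fin.
Qed.

Section PyramidAtoms.
Variables (R : realType) (P : set (mmspace R)).
Hypothesis hP : pyramid P.

Definition pyr_topw K : R := inf [set topw X K | X in P].
Definition pyr_atomw k : R := pyr_topw k.+1 - pyr_topw k.

Let topw_ge0 (X : mmspace R) K : 0 <= topw X K.
Proof. by apply: sumr_ge0 => k _; exact: atomw_ge0. Qed.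

Lemma pyr_topw_le X K : P X -> pyr_topw K <= topw X K.
Proof.
move=> PX; apply: ge_inf; last by exists X.
by exists 0 => _ [Y _ <-].
Qed.

(** Each step dominates the current space and a near-minimiser of [topw K] by a common element of
    [P]. By [topw_dominated] the bounds already obtained survive. *)
Lemma pyr_topw_approx X K e : P X -> 0 < e ->
  exists Z, [/\ P Z, dominated X Z & forall k, (k < K)%N -> topw Z k < pyr_topw k + e].
Proof.
move=> PX e0; elim: K => [|K [Z [PZ XZ hZ]]].
  by exists X; split => //; exact: dominated_refl.
have [W PW hW] : exists2 W, P W & topw W K < pyr_topw K + e.
  have /(inf_adherent e0) [_ [W PW <-] hW] : has_inf [set topw Y K | Y in P].
    by split; [exists (topw X K), X|exists 0 => _ [Y _ <-]].
  by exists W.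
case: hP => _ _ _ /(_ _ _ PZ PW) [V PV [ZV WV]].
exists V; split => //; first exact: dominated_trans ZV.
move=> k; rewrite ltnS leq_eqVlt => /orP[/eqP ->|kK].
  exact: le_lt_trans (topw_dominated _ WV) hW.
exact: le_lt_trans (topw_dominated _ ZV) (hZ _ kK).
Qed.

Lemma pyr_atomw_approx X K e : P X -> 0 < e ->
  exists Z, [/\ P Z, dominated X Z &
    forall k, (k < K)%N -> `|atomw Z k - pyr_atomw k| < e].
Proof.
(* The weight of index [k] is the difference of the sums at [k + 1] and [k], hence the bound [K.+1].
   Both sums exceed their infima by less than [e], so the difference is off by less than [e]. *)
move=> PX e0; have [Z [PZ XZ hZ]] := pyr_topw_approx K.+1 PX e0.
exists Z; split => // k kK; rewrite /pyr_atomw.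
have := pyr_topw_le k PZ; have := pyr_topw_le k.+1 PZ.
have := hZ _ (ltnW kK : (k < K.+1)%N); have := hZ k.+1 kK.
have -> : topw Z k.+1 = topw Z k + atomw Z k by rewrite /topw big_ord_recr.
by rewrite ltr_norml; lra.
Qed.

(** Nonnegativity and monotonicity pass to the limit from the atom weights of approximating spaces.
    The partial sums telescope and are bounded by [topw X n]. *)
Lemma seqA_pyr_atomw : seqA pyr_atomw.
Proof.
have [[X PX] _ _ _] := hP.
have h k e : 0 < e -> exists Z, `|atomw Z k - pyr_atomw k| < e /\
    `|atomw Z k.+1 - pyr_atomw k.+1| < e.
  move=> e0; have [Z [_ _ hZ]] := pyr_atomw_approx k.+2 PX e0.
  by exists Z; split; apply: hZ.
have a0 k : 0 <= pyr_atomw k.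
  apply/ler_addgt0Pr => e e0; have [Z []] := h k _ e0.
  by have := atomw_ge0 Z k; rewrite ltr_norml; lra.
split => // [k|].
  apply/ler_addgt0Pr => e e0; have [Z []] := h k _ (divr_gt0 e0 (ltr0n _ 2)).
  by have := atomw_noninc Z k; rewrite !ltr_norml; lra.
apply: nneseries_le_partial => // n.
rewrite -(big_mkord xpredT) telescope_sumr // (le_trans _ (topw_le1 X n)) //.
rewrite lerBlDr (le_trans (pyr_topw_le _ PX)) // lerDl.
by apply: lb_le_inf; [exists (topw X 0), X|move=> _ [Y _ <-]].
Qed.

(* Each [f_n (atom k of Z_n)] ranges over the finitely many atoms of [X] of mass
   at least half the limit weight, so it converges along an ultrafilter. *)
Lemma pyramid_sub_PA : P `<=` PA pyr_atomw.
Proof.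
move=> X PX; have [a0 _ _] := seqA_pyr_atomw.
have inv0 n : 0 < n.+1%:R^-1 :> R by rewrite invr_gt0 ltr0n.
have /choice [Z hZ] := fun n => pyr_atomw_approx n.+1 PX (inv0 n).
have /choice [x hx] : forall n, exists x : nat -> X, forall B K, borel B ->
    \sum_(k < K) atomw (Z n) k * \1_B (x k) <= mmeas B.
  move=> n; have [_ [f [fl fm]] _] := hZ n.
  exists (fun k => f (atom (Z n) k)) => B K bB; rewrite -fm //.
  exact: (atomw_sum_le K (borel_dominated fl bB)).
have [U [uU ooU]] := ultraFilterLemma eventually_filter.
have near_inv (e : R) : 0 < e -> \forall n \near U, n.+1%:R^-1 < e.
  move=> e0; have h := near_infty_natSinv_lt (PosNum e0); exact: (ooU _ h).
have near_ge N : \forall n \near U, (N <= n)%N by apply: ooU; exact: nbhs_infty_ge.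
have xlim k : 0 < pyr_atomw k -> exists y, \forall n \near U, x n k = y.
  move=> ak0; have ak2 : 0 < pyr_atomw k / 2 by rewrite divr_gt0.
  (* By [atomw_small], a point of mass above [1 / (J + 1)] must be one of the first [J] atoms of
     [X]. *)
  have [J hJ] := ltr_add_invr ak2; rewrite add0r in hJ.
  have : \forall n \near U, exists2 j, (j < J)%N & atom X j = x n k.
    near=> n; apply/topsetP; apply: contrapT => nt.
    suff : J.+1%:R^-1 < atomw X J by rewrite ltNge atomw_small.
    have hm : mmeas [set x n k] <= atomw X J by exact: atomw_max.
    apply: lt_le_trans hm; apply: (lt_trans hJ).
    have [_ _ hZn] := hZ n.
    have kn : (k <= n)%N by near: n; exact: near_ge.
    have hn : n.+1%:R^-1 < pyr_atomw k / 2 by near: n; exact: near_inv.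
    have wk : pyr_atomw k / 2 < atomw (Z n) k.
      have := hZn k kn; rewrite ltr_norml => /andP[+ _].
      move: hn; set e := n.+1%:R^-1; lra.
    apply: (lt_le_trans wk).
    have := hx n [set x n k] k.+1 (borel1 _).
    apply: le_trans; rewrite big_ord_recr /= indicE mem_set // mulr1 lerDr.
    by apply: sumr_ge0 => i _; rewrite mulr_ge0 ?atomw_ge0.
  (* Pigeonhole along the ultrafilter: either [x n k] is [atom X J] for almost all [n], or this
     candidate is excluded and [J] decreases. *)
  elim: J {hJ} => [|J IH] h.
    by have /filter_ex [n []] := h.
  have [hh|hh] := in_ultra_setVsetC [set n | x n k = atom X J] uU.
    by exists (atom X J).
  apply: IH; apply: filterS2 h hh => n [j]; rewrite ltnS leq_eqVlt.
  by move=> /orP[/eqP -> hj []|jJ hj _]; [rewrite hj|exists j].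
have /choice [y hy] : forall k, exists y, 0 < pyr_atomw k -> \forall n \near U, x n k = y.
  move=> k; have [/xlim [y hy]|h] := pselect (0 < pyr_atomw k); first by exists y.
  by have [z _] := mmspace_inhabited X; exists z.
have ally K : \forall n \near U, forall k, (k < K)%N -> 0 < pyr_atomw k -> x n k = y k.
  elim: K => [|K IH]; first by apply: nearW.
  have hK : \forall n \near U, 0 < pyr_atomw K -> x n K = y K.
    have [h|h] := pselect (0 < pyr_atomw K); last by apply: nearW => n /h.
    by apply: filterS (hy _ h) => n ->.
  apply: filterS2 IH hK => n h1 h2 k.
  by rewrite ltnS leq_eqVlt => /orP[/eqP ->|/h1].
exists y => B bB; apply: nneseries_le_partial => [i|K].
  by rewrite mulr_ge0.
apply/ler_addgt0Pr => e e0.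
(* Each of the [K] weights may be off by [1 / (n + 1)], so this bound keeps the total error below
   [e]. *)
have eK : 0 < e / K.+1%:R by rewrite divr_gt0 ?ltr0n.
have /filter_ex [n [h1 [h2 h3]]] : \forall n \near U,
    (forall k, (k < K)%N -> 0 < pyr_atomw k -> x n k = y k) /\
    ((K <= n)%N /\ n.+1%:R^-1 < e / K.+1%:R).
  by apply: filterS3 (ally K) (near_ge K) (near_inv _ eK).
have [_ _ hZn] := hZ n.
have ek : \sum_(k < K) (n.+1%:R^-1 : R) <= e.
  rewrite sumr_const card_ord -(mulr_natr _ K).
  move: h3; rewrite ltr_pdivlMr ?ltr0n // => h3.
  apply: le_trans (ltW h3);  apply: ler_wpM2l; first exact: ltW.
  by rewrite ler_nat.
apply: le_trans (lerD (hx n B K bB) ek); rewrite -big_split /=; apply: ler_sum => k _.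
have [ak|ak] := ltP 0 (pyr_atomw k); last first.
  have -> : pyr_atomw k = 0 by apply/eqP; rewrite eq_le ak a0.
  by rewrite mul0r addr_ge0 ?mulr_ge0 ?atomw_ge0 // ltW.
rewrite (h1 k) // !indicE.
have := hZn k (leq_trans (ltn_ord k) (leq_trans h2 (leqnSn n))).
have := inv0 n; set i := n.+1%:R^-1.
case: (_ \in B); rewrite ?mulr1 ?mulr0 ?add0r ltr_norml; lra.
Unshelve. all: by end_near. Qed.

End PyramidAtoms.

(** * Upper bounds on the box distance *)

Section ImageSpace.
Variables (R : realType) (X : mmspace R) (T : Type) (d : T -> T -> R) (f : X -> T).
Hypotheses (dm : is_metric d) (dc : mcomplete d).
Hypothesis f_borel : forall U, mopen d U -> borel (f @^-1` U).
Hypothesis f_sep : exists u : nat -> X,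
  forall x e, 0 < e -> exists n, d (f x) (f (u n)) < e.
Hypothesis f_supp : forall x r, 0 < r -> 0 < mmeas (f @^-1` mball d (f x) r).

Let S t := forall e, 0 < e -> exists x, d (f x) t < e.
Let V := {t | S t}.
Let dV (a b : V) := d (sval a) (sval b).

Let Sf x : S (f x).
Proof. by move=> e e0; exists x; case: dm => _ d0 _ _; rewrite (d0 _ _).2. Qed.

Let g x : V := exist _ (f x) (Sf x).
Let muV (B : set V) := mmeas (g @^-1` B).

Let sval_inj (a b : V) : sval a = sval b -> a = b.
Proof.
case: a b => [a Sa] [b Sb] /= ab; subst b; congr exist; exact: Prop_irrelevance.
Qed.

Let dVm : is_metric dV.
Proof.
case: dm => d0 dx ds dt; split=> [a b|a b|a b|a b c]; rewrite /dV //.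
by split=> [/dx/sval_inj //|->]; exact/dx.
Qed.

Let dVc : mcomplete dV.
Proof.
case: dm => d0 dx ds dt u /= uC; have [l lP] := dc uC.
have Sl : S l.
  move=> e e0; have e2 : 0 < e / 2 by rewrite divr_gt0.
  have [N hN] := lP _ e2; have [x hx] := svalP (u N) _ e2.
  exists x; apply: (le_lt_trans (dt _ (sval (u N)) _)).
  by have := hN N (leqnn N); lra.
by exists (exist _ l Sl).
Qed.

Let dVs : mseparable dV.
Proof.
case: dm => d0 dx ds dt; have [u uP] := f_sep.
exists (fun n => g (u n)) => -[a Sa] e e0; rewrite /dV /=.
have e2 : 0 < e / 2 by rewrite divr_gt0.
have [x hx] := Sa _ e2; have [n hn] := uP x _ e2.
exists n; apply: (le_lt_trans (dt _ (f x) _)).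
by rewrite ds; lra.
Qed.

Let g_borel B : mborel dV B -> borel (g @^-1` B).
Proof.
case: dm => d0 dx ds dt; apply: mborel_preimage => U oU.
(* [W] is the union of the balls of [T] centred in [V] whose trace on [V] lies in [U]. It is open in
   [T] and has the same preimage as [U]. *)
pose W := [set t | exists a r, [/\ 0 < r, mball dV a r `<=` U & d (sval a) t < r]].
have oW : mopen d W.
  move=> t [a [r [r0 aU at_]]]; exists (r - d (sval a) t); first by rewrite subr_gt0.
  move=> s; rewrite /mball /= => ts; exists a, r; split => //.
  by apply: (le_lt_trans (dt _ t _)); lra.
have := f_borel oW; congr (borel _); apply/seteqP; split=> x /=.
  by move=> [a [r [r0 aU ax]]]; exact: aU.
move=> Ux; have [r r0 rU] := oU _ Ux; exists (g x), r; split => //=.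
by rewrite (dx _ _).2.
Qed.

Let muVp : borel_prob dV muV.
Proof.
have [m0 mT mU] := mmeas_prob X; rewrite /muV; split.
- by move=> A bA; apply: m0; exact: g_borel.
- exact: mT.
- move=> F bF tF; rewrite preimage_bigcup.
  have := mU (fun n => g @^-1` F n); apply; first by move=> n; exact: g_borel.
  apply/trivIsetP => i j _ _ ij; move/trivIsetP : tF => /(_ i j I I ij).
  by rewrite -preimage_setI => ->.
Qed.

Let muVs x r : 0 < r -> 0 < muV (mball dV x r).
Proof.
case: dm => d0 dx ds dt; case: x => a Sa r0; have r2 : 0 < r / 2 by rewrite divr_gt0.
have [x hx] := Sa _ r2; apply: (lt_le_trans (f_supp x r2)).
apply: mu_le; first by apply: f_borel; exact: mopen_ball.
- by apply: g_borel; apply: mborel_open; exact: mopen_ball.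
- move=> y; rewrite /mball /dV /= => xy; apply: (le_lt_trans (dt _ (f x) _)).
  by rewrite (ds a); lra.
Qed.

(* [V] is the closure of [range f] with the push-forward measure, [g] is [f]
   with restricted codomain and [h] is the inclusion. *)
Lemma image_space : exists (V : mmspace R) (g : X -> V) (h : V -> T),
  [/\ forall x, h (g x) = f x, forall a b, mdist a b = d (h a) (h b),
      forall B, borel B -> borel (g @^-1` B),
      forall B, borel B -> mmeas (g @^-1` B) = mmeas B &
      forall a e, 0 < e -> exists x, d (f x) (h a) < e].
Proof.
exists (MMSpace dVm dVc dVs muVp muVs), g, sval; split => //.
by move=> [a Sa] e e0 /=; exact: Sa.
Qed.

End ImageSpace.

(** * Box estimates and approximation by finite spaces *)

Section Box.
Variable R : realType.
Implicit Types X Y F : mmspace R.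

Lemma box_ge0 X Y : 0 <= box X Y.
Proof.
rewrite /box; set E := [set e | _]; have [[e Ee]|E0] := pselect (E !=set0).
  by apply: lb_le_inf; [exists e|move=> x []].
by rewrite (_ : E = set0) ?inf0 //; apply/seteqP; split=> x // Ex; case: E0; exists x.
Qed.

(* If one of the spaces had no parameter, [box X Y] would be the junk value
   [inf set0 = 0]; so parameters may be assumed to exist when bounding [box]. *)
Lemma box_le X Y e : 0 <= e ->
  ((exists phi : R -> X, parameter phi) -> (exists psi : R -> Y, parameter psi) ->
   box_ok X Y e) -> box X Y <= e.
Proof.
move=> e0 h; rewrite /box; set E := [set e | _].
have [[e' [e'0 [phi [psi [I0 [hphi hpsi hI hl hd]]]]]]|E0] := pselect (E !=set0).
  apply: ge_inf; first by exists 0 => x [].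
  by split => //; apply: h; [exists phi|exists psi].
by rewrite (_ : E = set0) ?inf0 //; apply/seteqP; split=> x // Ex; case: E0; exists x.
Qed.

(** A parameter [psi] of [X] yields the parameter [g \o psi] of [F]. The two are compared on the
    preimage of [G] under [psi]. *)
Lemma box_image X F (g : X -> F) (G : set X) e : 0 <= e ->
  (forall B, borel B -> borel (g @^-1` B)) ->
  (forall B, borel B -> mmeas (g @^-1` B) = mmeas B) ->
  borel G -> 1 - e <= mmeas G ->
  (forall x x', G x -> G x' -> `|mdist (g x) (g x') - mdist x x'| <= e) ->
  box F X <= e.
Proof.
move=> e0 gb gm bG Ge dG; apply: box_le => // _ [psi [psib psim]].
exists (g \o psi), psi, (@I01 R `&` psi @^-1` G); split.
- split=> B bB; first by apply: (psib (g @^-1` B)); exact: gb.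
  by rewrite -gm //; apply: (psim (g @^-1` B)); exact: gb.
- by [].
- by split; [exact: psib|exact: subIsetl].
- by rewrite psim // lee_fin.
- by move=> s t [_ Gs] [_ Gt]; exact: dG.
Qed.

(** Continuity from below: finitely many balls of a countable cover already leave less than [e] of
    the mass to the leftover cell. *)
Lemma first_ball_cover X (c : nat -> X) (r : nat -> R) e : 0 < e ->
  (forall x, exists l, mdist (c l) x < r l) ->
  exists N, forall M, (N <= M)%N ->
    1 - e < mmeas [set x | (first_ball c r M x < M)%N].
Proof.
move=> e0 hc; pose F n := [set x | exists2 l, (l < n)%N & mdist (c l) x < r l].
have bF n : borel (F n).
  rewrite (_ : F n = \bigcup_l (mball (@mdist _ X) (c l) (r l) `&` [set _ | (l < n)%N])).
    apply: mborel_bigcup => l; apply: mborelI; first exact: borel_ball.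
    exact: mborel_const.
  by apply/seteqP; split=> x /= => [[l ln lx]|[l _ [lx ln]]]; exists l.
have sF m n : (m <= n)%N -> F m `<=` F n.
  by move=> mn x [l lm lx]; exists l => //; exact: leq_trans mn.
have [N hN] := mu_bigcup_approx bF (fun n => sF _ _ (leqnSn n)) e0.
exists N => M NM; move: hN; rewrite (_ : \bigcup_n F n = setT); last first.
  by apply/seteqP; split=> x // _; have [l lx] := hc x; exists l.+1 => //; exists l.
rewrite muT => /lt_le_trans; apply; apply: mu_le => //.
  by apply: (borel_fibre (fun k => (k < M)%N)); exact: borel_first_ball.
move=> x /(sF _ _ NM) [l lM lx] /=.
rewrite ltnNge; apply/negP => Mg; have := first_ball_ge (leq_trans lM Mg).
by rewrite leNgt lx.
Qed.

(** Each cell of a partition by balls of radius [e / 2] is sent to one centre. The map preserves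
    measure, so it carries witnesses of [PA a X] to witnesses of [PA a F]. *)
Lemma finite_approx X e : 0 < e -> exists F : mmspace R,
  [/\ box F X <= e, forall a, PA a X -> PA a F &
      exists M (s : nat -> F), forall y, exists2 l, (l <= M)%N & s l = y].
Proof.
move=> e0; have e2 : 0 < e / 2 by rewrite divr_gt0.
have [q qP] := mdist_separable X.
have [N hN] := first_ball_cover (c := q) (r := fun=> e / 2) e0
  (fun x => let: ex_intro n h := qP x _ e2 in ex_intro _ n
     (eq_ind _ (fun z => z < e / 2) h _ (mdistC x (q n)))).
have {hN} := hN N (leqnn N); set g := first_ball _ _ _ => hg.
have bg n : borel (g @^-1` [set n]) by exact: borel_first_ball.
pose D l := 0 < mmeas (g @^-1` [set l]).
have mD l : mmeas (g @^-1` [set l]) = if D l then mmeas (g @^-1` [set l]) else 0.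
  by rewrite /D; case: ltP => // h; apply/eqP; rewrite eq_le h mu_ge0.
have [l0 l0N Dl0] : exists2 l, (l <= N)%N & D l.
  apply: contrapT => nD; have := mu_fibre xpredT N.+1 bg.
  rewrite big1 => [|i _]; last first.
    by rewrite mD; case: ifP => // Di; case: nD; exists i => //; rewrite -ltnS.
  rewrite (_ : [set _ | _] = setT) ?muT; first by move/eqP; rewrite oner_eq0.
  by apply/seteqP; split=> x //= _; rewrite andbT ltnS; exact: first_ball_le.
(* Null cells are rerouted to the centre of a cell [l0] of positive mass. Every value of [p] is then
   taken with positive mass, as full support of the image requires. *)
pose k l := if D l then l else l0.
have Dk l : D (k l) by rewrite /k; case: ifP.
pose p x := q (k (g x)).
have pb (U : set X) : borel (p @^-1` U) by exact: (borel_fibre (fun n => U (q (k n)))).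
have kk l : k (k l) = k l by rewrite {1}/k Dk.
have [x0 _] := mmspace_inhabited X.
have /choice [u hu] : forall n, exists y, forall x, k (g x) = n -> k (g y) = n.
  move=> n; have [[x hx]|h] := pselect (exists x, k (g x) = n); first by exists x.
  by exists x0 => x hx; case: h; exists x.
have [|x r r0|V [i [h [hi dV ib im hcl]]]] :=
  @image_space _ X X (@mdist _ X) p (mdist_metric X) (@mdist_complete _ X) (fun U _ => pb U).
- by exists u => x r r0; exists (k (g x)); rewrite /p (hu _ x) // distxx.
- apply: (lt_le_trans (Dk (g x))); apply: mu_le => //.
  by move=> y /= gy; rewrite /mball /= /p gy kk distxx.
have hinj a b : h a = h b -> a = b by move=> ab; apply/dist_eq0; rewrite dV ab distxx.
exists V; split.
(* On the cells of positive mass below [N], the map moves points by less than [e / 2], so distances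
   change by at most [e]. *)
- apply: (@box_image _ _ i [set x | (g x < N)%N && D (g x)]) => //.
  + exact: ltW.
  + exact: (borel_fibre (fun n => (n < N)%N && D n)).
  + rewrite mu_fibre // big_mkcond /= (eq_bigr (fun l : 'I_N => mmeas (g @^-1` [set (l : nat)]))).
      have := mu_fibre xpredT N bg; rewrite /= => <-.
      rewrite ltW // (lt_le_trans hg) // le_eqVlt; apply/orP; left; apply/eqP; congr mmeas.
      by apply/seteqP; split=> x /=; rewrite andbT.
    by move=> l _; rewrite -mD.
  + have hp x : (g x < N)%N && D (g x) -> mdist (p x) x < e / 2.
      by move=> /andP[gN Dg]; rewrite /p /k Dg; exact: first_ball_lt.
    move=> x x' /hp hx /hp hx'; rewrite dV !hi ler_norml.
    have := dist_tri x (p x) (p x'); have := dist_tri x' x (p x').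
    have := dist_tri (p x) x x'; have := dist_tri (p x') (p x) x'.
    by rewrite (mdistC x (p x)) (mdistC x' (p x')); lra.
- move=> a [x hx]; exists (fun n => i (x n)) => B bB; rewrite -im //.
  exact: hx (i @^-1` B) (ib _ bB).
- have /choice [s hs] : forall l, exists v : V, forall v', h v' = q l -> h v = q l.
    move=> l; have [[v hv]|nv] := pselect (exists v, h v = q l); first by exists v.
    by exists (i x0) => v hv; case: nv; exists v.
  exists N, s => v; apply: contrapT => nv.
  (* A point of [V] that is none of the finitely many centres would have positive distance to all of
     them, whereas it is a limit of values of [p]. *)
  have far n : (n <= N.+1)%N -> exists2 r, 0 < r & forall l, (l < n)%N -> r <= mdist (q l) (h v).
    elim: n => [_|n IH nN]; first by exists 1.
    have [r r0 hr] := IH (ltnW nN).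
    have qn : 0 < mdist (q n) (h v).
      rewrite lt_neqAle dist_ge0 andbT; apply/eqP => /esym/dist_eq0 qv.
      by apply: nv; exists n => //; apply: hinj; rewrite (hs n v).
    exists (Num.min r (mdist (q n) (h v))); first by rewrite lt_min r0 qn.
    move=> l; rewrite ltnS leq_eqVlt => /orP[/eqP ->|/hr lr]; first by rewrite ge_min lexx orbT.
    by rewrite ge_min lr.
  have [r r0 hr] := far _ (leqnn _); have [x hx] := hcl v _ r0.
  have : r <= mdist (p x) (h v).
    by apply: hr; rewrite ltnS /k; case: ifP => // _; exact: first_ball_le.
  by rewrite leNgt hx.
Qed.

End Box.

(** * Scaling and the separation distance *)

Section Scaling.
Variable R : realType.
Implicit Types (X Y : mmspace R) (P : set (mmspace R)) (t : R).

Lemma borel_scaled t X Y (f : X -> Y) (B : set Y) : 0 < t ->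
  (forall x x', mdist (f x) (f x') = t * mdist x x') -> borel B -> borel (f @^-1` B).
Proof.
by move=> t0 fl bB; apply: (mborel_lipschitz t0 _ bB) => x x'; rewrite fl.
Qed.

(** [X] is [Y] with its metric divided by [t], and the identity serves as similarity both ways. *)
Lemma scaled_space t Y : 0 < t ->
  exists X, scaled_iso t X Y /\ scaled_iso t^-1 Y X.
Proof.
move=> t0; have t0' : t != 0 by rewrite gt_eqF.
pose d (x y : Y) := t^-1 * mdist x y.
have ti : 0 < t^-1 by rewrite invr_gt0.
have dm : is_metric d.
  split=> [x y|x y|x y|x y z]; rewrite /d.
  - by rewrite mulr_ge0 ?dist_ge0 // ltW.
  - split=> [/eqP|->]; last by rewrite distxx mulr0.
    by rewrite mulf_eq0 invr_eq0 (negbTE t0') => /eqP/dist_eq0.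
  - by rewrite mdistC.
  - by rewrite -mulrDr ler_wpM2l ?dist_tri // ltW.
have ball_lt e x y : (d x y < e) = (mdist x y < t * e) by rewrite /d ltr_pdivrMl.
have dc : mcomplete d.
  move=> u uC; have [|l hl] := @mdist_complete _ Y u.
    move=> e e0; have [|N hN] := uC (t^-1 * e); first by rewrite mulr_gt0.
    by exists N => m n mN nN; have := hN m n mN nN; rewrite ball_lt mulVKf.
  exists l => e e0; have [|N hN] := hl (t * e); first by rewrite mulr_gt0.
  by exists N => n nN; rewrite ball_lt hN.
have ds : mseparable d.
  have [s hs] := mdist_separable Y; exists s => x e e0.
  by have [|n hn] := hs x (t * e); [rewrite mulr_gt0|exists n; rewrite ball_lt].
have b1 (A : set Y) : mborel d A -> borel A.
  by move=> bA; apply: (mborel_lipschitz (f := id) ti _ bA).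
have b2 (A : set Y) : borel A -> mborel d A.
  move=> bA; apply: (mborel_lipschitz (f := id) t0 _ bA) => x y.
  by rewrite /d mulrA divff // mul1r.
have dp : borel_prob d (@mmeas _ Y).
  have [m0 mT mU] := mmeas_prob Y; split=> // [A /b1|F bF]; first exact: m0.
  by apply: mU => n; exact: b1.
have dsu x r : 0 < r -> 0 < mmeas (mball d x r).
  move=> r0; rewrite (_ : mball d x r = mball (@mdist _ Y) x (t * r)).
    by apply: mmeas_full_support; rewrite mulr_gt0.
  by apply/seteqP; split=> y; rewrite /mball /= ball_lt.
exists (MMSpace dm dc ds dp dsu); split; exists id;
  (split; first by exists id); split=> // x x' /=; by rewrite /d ?mulrA ?divff ?mul1r.
Qed.

Lemma PA_scaled t X Y (a : nat -> R) : 0 < t -> scaled_iso t X Y -> PA a X -> PA a Y.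
Proof.
move=> t0 [f [_ [fl fm]]] [x hx]; exists (fun i => f (x i)) => B bB.
by rewrite -fm //; exact: hx (f @^-1` B) (borel_scaled t0 fl bB).
Qed.

Lemma fixed_PA (a : nat -> R) : fixed_pyr (PA a).
Proof.
move=> t t0; apply/seteqP; split=> [Y [X PX XY]|Y PY]; first exact: PA_scaled XY PX.
have [X [XY YX]] := scaled_space Y t0.
by exists X => //; apply: PA_scaled YX PY; rewrite invr_gt0.
Qed.

Local Open Scope ereal_scope.

Lemma set_dist_ge0 X (A B : set X) : 0 <= set_dist A B.
Proof. by apply: le_ereal_inf_tmp => _ [a _ [b _ <-]]; rewrite lee_fin dist_ge0. Qed.

Lemma Sep_mm_ge0 X N (kappa : 'I_N.+1 -> R) : 0 <= Sep_mm X kappa.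
Proof.
rewrite /Sep_mm; case: asboolP => // nk; apply: le_trans (ereal_sup_ubound _); last first.
  exists (fun=> setT) => //= i; split; first exact: mborelT.
  by rewrite muT leNgt; apply/negP => ki; apply: nk; exists i.
by apply: le_ereal_inf_tmp => _ [i [j [_ ->]]]; exact: set_dist_ge0.
Qed.

Lemma Sep_mm_scaled t X Y N (kappa : 'I_N.+1 -> R) : (0 < t)%R ->
  scaled_iso t X Y -> Sep_mm Y kappa <= t%:E * Sep_mm X kappa.
Proof.
move=> t0 [f [_ [fl fm]]]; rewrite /Sep_mm; case: asboolP => _; first by rewrite mule0.
apply: ge_ereal_sup => _ [A hA <-].
pose A' i := f @^-1` A i.
have hA' i : borel (A' i) /\ (kappa i <= mmeas (A' i))%R.
  by have [bA kA] := hA i; rewrite fm //; split=> //; exact: borel_scaled fl bA.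
apply: (@le_trans _ _ (t%:E *
    ereal_inf [set s | exists i j, i != j /\ s = set_dist (A' i) (A' j)])); last first.
  by apply: lee_wpmul2l; [rewrite lee_fin ltW|apply: ereal_sup_ubound; exists A'].
rewrite -lee_pdivrMl //; apply: le_ereal_inf_tmp => _ [i [j [ij ->]]].
apply: le_ereal_inf_tmp => _ [a Aa [b Ab <-]].
rewrite lee_pdivrMl //; apply: ge_ereal_inf; exists (set_dist (A i) (A j)).
  by exists i, j.
apply: ge_ereal_inf; exists (mdist (f a) (f b))%:E; first by exists (f a) => //; exists (f b).
by rewrite fl EFinM.
Qed.

Lemma Sep_mm_anti X N (kappa kappa' : 'I_N.+1 -> R) :
  (forall i, kappa i <= kappa' i)%R -> Sep_mm X kappa' <= Sep_mm X kappa.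
Proof.
move=> kk; rewrite {1}/Sep_mm; case: asboolP => [_|nk']; first exact: Sep_mm_ge0.
rewrite /Sep_mm asboolF => [|[i ki]]; last first.
  by apply: nk'; exists i; exact: lt_le_trans (kk i).
apply: ereal_sup_le => _ [A hA <-]; exists A => // i.
by have [bA kA] := hA i; split=> //; exact: le_trans kA.
Qed.

Lemma Sep_delta_ge0 P N (kappa : 'I_N.+1 -> R) delta :
  (exists X, P X) -> 0 <= Sep_pyr_delta P kappa delta.
Proof.
move=> [X PX]; apply: le_ereal_sup_tmp; exists (Sep_mm X (fun i => kappa i - delta)%R).
  by exists X.
exact: Sep_mm_ge0.
Qed.

(** [Sep_pyr_delta] is nondecreasing in [delta], so its right limit at 0 is an infimum. *)
Lemma Sep_pyrE P N (kappa : 'I_N.+1 -> R) :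
  Sep_pyr P kappa =
  ereal_inf [set Sep_pyr_delta P kappa delta | delta in [set delta | (0 < delta)%R]].
Proof.
apply/cvg_lim => //.
rewrite (_ : [set delta | (0 < delta)%R] = [set` `]0%R, +oo[%R]); last first.
  by apply/seteqP; split=> x /=; rewrite in_itv /= andbT.
apply: nondecreasing_at_right_cvge => // x y _ _ xy.
apply: ge_ereal_sup => _ [X PX <-].
apply: (@le_trans _ _ (Sep_mm X (fun i => kappa i - y)%R)).
  by apply: Sep_mm_anti => i; rewrite lerB.
by apply: ereal_sup_ubound; exists X.
Qed.

(** At each [delta], invariance gives [S delta <= u * S delta] with [u < 1], which forces the value
    0 or [+oo]. The infimum over [delta] inherits the alternative. *)
Lemma scale_invariant_Sep P t N (kappa : 'I_N.+1 -> R) :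
  (exists X, P X) -> (0 < t)%R -> t != 1%R -> scale_pyr t P = P ->
  Sep_pyr P kappa = 0 \/ Sep_pyr P kappa = +oo.
Proof.
move=> PX t0 t1 tP; rewrite Sep_pyrE; set S := Sep_pyr_delta P kappa.
have [u [u0 u1 hu]] : exists u, [/\ (0 < u)%R, (u < 1)%R & forall delta, S delta <= u%:E * S delta].
  have [t_lt1|t_gt1|/eqP] := ltgtP t 1%R; last by rewrite (negbTE t1).
    exists t; split => // delta; apply: ge_ereal_sup => _ [X + <-].
    rewrite -{1}tP => -[Y PY YX]; apply: le_trans (Sep_mm_scaled _ t0 YX) _.
    apply: lee_wpmul2l; first by rewrite lee_fin ltW.
    by apply: ereal_sup_ubound; exists Y.
  (* For [t > 1] the factor is [t^-1]: each [X] in [P] is the [t^-1]-scaling of a space in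
     [scale_pyr t P], which is [P]. *)
  have ti : (0 < t^-1)%R by rewrite invr_gt0.
  exists t^-1%R; split => //; first by rewrite invf_lt1.
  move=> delta; apply: ge_ereal_sup => _ [X PX' <-].
  have [Y [YX XY]] := scaled_space X ti; rewrite invrK in XY.
  apply: le_trans (Sep_mm_scaled _ ti YX) _.
  apply: lee_wpmul2l; first by rewrite lee_fin ltW.
  by apply: ereal_sup_ubound; exists Y => //; rewrite -tP; exists X.
have S0 delta : 0 <= S delta by exact: Sep_delta_ge0.
have S0y delta : S delta = 0 \/ S delta = +oo.
  have := hu delta; have := S0 delta; case: (S delta) => [r| |] //.
  - rewrite -EFinM !lee_fin => r0 ru; left; congr EFin; nra.
  - by right.
have [[delta d0 Sd]|h] := pselect (exists2 delta, (0 < delta)%R & S delta = 0).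
  left; apply/eqP; rewrite eq_le; apply/andP; split.
    by apply: ge_ereal_inf; exists 0 => //; exists delta.
  by apply: le_ereal_inf_tmp => _ [x _ <-].
right; apply/ereal_inf_pinfty => _ [delta d0 <-] /=.
by have [Sd|//] := S0y delta; case: h; exists delta.
Qed.

End Scaling.

(** * Couplings on the unit interval *)

Section Splitting.
Variable R : realType.
Local Notation leb := (@leb R).
Local Notation I01 := (@I01 R).

Lemma Rborel_I01 : Rborel I01.
Proof. exact: measurable_itv. Qed.

Lemma leb_I01 : leb I01 = 1%:E.
Proof. by rewrite /Defs.leb lebesgue_measure_itv /= lte_fin ltr01 oppr0 adde0. Qed.

Lemma leb_le1 M : Rborel M -> M `<=` I01 -> (leb M <= 1%:E)%E.
Proof.
by move=> mM MI; rewrite -leb_I01; apply: le_measure; rewrite ?inE //; exact: Rborel_I01.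
Qed.

Lemma leb_fin M : Rborel M -> M `<=` I01 -> (fine (leb M))%:E = leb M.
Proof.
move=> mM MI; rewrite fineK // ge0_fin_numE; last exact: measure_ge0.
by rewrite (le_lt_trans (leb_le1 mM MI)) // ltry.
Qed.

Lemma leb_setU A B : Rborel A -> Rborel B -> A `&` B = set0 ->
  leb (A `|` B) = (leb A + leb B)%E.
Proof. by move=> mA mB AB; exact: measureU. Qed.

(** The measure of the part of [M] to the left of [s] is 1-Lipschitz in [s], so the intermediate
    value theorem supplies the cut. *)
Lemma leb_split M c : Rborel M -> M `<=` I01 -> 0 <= c -> (c%:E <= leb M)%E ->
  exists M', [/\ Rborel M', M' `<=` M & leb M' = c%:E].
Proof.
move=> mM MI c0 cM; pose F s := M `&` `]-oo, s[%classic.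
have mF s : Rborel (F s) by apply: measurableI => //; exact: measurable_itv.
have FI s : F s `<=` I01 by move=> x [/MI].
pose m s := fine (leb (F s)).
have lip s t : s <= t -> 0 <= m t - m s <= t - s.
  move=> st; have E : F t = F s `|` (M `&` `[s, t[%classic).
    rewrite /F -setIUr; congr (_ `&` _); apply/seteqP; split=> x /=; rewrite !in_itv /=.
      by move=> xt; case: (ltP x s) => xs; [left|right].
    by move=> [xs|/andP[_ //]]; exact: lt_le_trans st.
  have mD : Rborel (M `&` `[s, t[%classic).
    by apply: measurableI => //; exact: measurable_itv.
  have DI : M `&` `[s, t[%classic `<=` I01 by move=> x [/MI].
  have mE : m t = m s + fine (leb (M `&` `[s, t[%classic)).
    rewrite /m -fineD ?E ?leb_setU //.
    - apply/seteqP; split=> x //= [[_]]; rewrite !in_itv /= => xs [_ /andP[sx _]].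
      by have := lt_le_trans xs sx; rewrite ltxx.
    - by rewrite -leb_fin.
    - by rewrite -(leb_fin mD).
  rewrite mE addrAC subrr add0r -lee_fin leb_fin //; apply/andP; split.
    exact: measure_ge0.
  rewrite -lee_fin leb_fin //; apply: (@le_trans _ _ (leb `[s, t[%classic)).
    by apply: le_measure; rewrite ?inE //; exact: measurable_itv.
  rewrite /Defs.leb lebesgue_measure_itv /= lte_fin; case: ifP => // _.
  by rewrite lee_fin subr_ge0.
have mc : {within `[0, 1], continuous m}.
  apply: continuous_subspaceT => x; apply/cvgrPdist_lt => e e0.
  near=> y; have xy : `|x - y| < e by near: y; exact: cvgr_dist_lt.
  apply: le_lt_trans xy; have [h|h] := leP x y.
    have /andP[h1 h2] := lip _ _ h.
    have -> : `|m x - m y| = m y - m x by rewrite distrC ger0_norm.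
    by rewrite distrC ger0_norm // subr_ge0.
  have /andP[h1 h2] := lip _ _ (ltW h).
  have -> : `|m x - m y| = m x - m y by rewrite ger0_norm.
  by rewrite ger0_norm // subr_ge0 ltW.
have m0 : m 0 = 0.
  rewrite /m (_ : F 0 = set0) ?/Defs.leb ?measure0 //; apply/seteqP; split=> x // [/MI].
  by rewrite /Defs.I01 /= !in_itv /= => /andP[x0 _]; rewrite ltNge x0.
have m1 : c <= m 1.
  rewrite -lee_fin leb_fin // (_ : F 1 = M) //; apply/seteqP; split=> x; first by case.
  by move=> Mx; split=> //; have := MI _ Mx; rewrite /Defs.I01 /= !in_itv => /andP[].
have [|s _ hs] := IVT (@ler01 R) mc (v := c).
  by rewrite m0 ge_min c0 le_max m1 orbT.
by exists (F s); split=> //; [move=> x []|rewrite -leb_fin // -hs].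
Unshelve. all: by end_near. Qed.

Lemma leb_pieces n (c : nat -> R) M : Rborel M -> M `<=` I01 ->
  (forall i, 0 <= c i) -> ((\sum_(i < n) c i)%:E <= leb M)%E ->
  exists D : nat -> set R, [/\ forall i, Rborel (D i), forall i, D i `<=` M,
    forall i, (i < n)%N -> leb (D i) = (c i)%:E &
    forall i j, (i < n)%N -> (j < n)%N -> i != j -> D i `&` D j = set0].
Proof.
move=> + + c0; elim: n M => [|n IH] M mM MI cM.
  exists (fun=> set0); split=> [i|i|//|//]; last exact: sub0set.
  exact: (@measurable0 _ (measurableTypeR R)).
rewrite big_ord_recr /= in cM.
have [|M' [mM' M'M lM']] := leb_split mM MI (c0 n).
  by apply: le_trans cM; rewrite lee_fin lerDr sumr_ge0.
have mD : Rborel (M `\` M') by apply: measurableD.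
have DI : M `\` M' `<=` I01 by move=> x [/MI].
have [|D [mDi DM lD tD]] := IH (M `\` M') mD DI.
  have : leb M = (leb M' + leb (M `\` M'))%E.
    by rewrite -leb_setU ?setDUK //; apply/seteqP; split=> x //= [? []].
  move: cM => /[swap] ->; rewrite lM' EFinD addeC -(leb_fin mD DI) -!EFinD !lee_fin; lra.
exists (fun i => if i == n then M' else D i); split=> [i|i|i|i j].
- by case: eqP.
- by case: eqP => // _ x /DM [].
- by rewrite ltnS leq_eqVlt; case: eqP => [->//|_ /= /lD].
- rewrite !ltnS (leq_eqVlt i) (leq_eqVlt j); case: eqP => [->|_] /=; case: eqP => [->|_] //=.
  + by rewrite eqxx.
  + by move=> _ jn _; apply/seteqP; split=> x // -[M'x /DM []].
  + by move=> jn _ _; apply/seteqP; split=> x // -[/DM []].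
  + exact: tD.
Qed.

Lemma leb_bigsetU (D : nat -> set R) n : (forall i, Rborel (D i)) ->
  (forall i j, (i < n)%N -> (j < n)%N -> i != j -> D i `&` D j = set0) ->
  leb (\big[setU/set0]_(i < n) D i) = (\sum_(i < n) leb (D i))%E.
Proof.
move=> mD; elim: n => [|n IH] tD; first by rewrite !big_ord0 /Defs.leb measure0.
rewrite !big_ord_recr /= leb_setU // ?IH //.
- by move=> i j ni nj; apply: tD; rewrite ltnW.
- by apply: bigsetU_measurable => i _; exact: mD.
- apply/seteqP; split=> x // []; rewrite -bigcup_mkord => -[i /= ltin Di] Dn.
  have := tD i n (ltnW ltin : (i < n.+1)%N) (ltnSn n); rewrite neq_ltn ltin => /(_ isT) E.
  suff : (D i `&` D n) x by rewrite E.
  by split.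
Qed.

(** Keep a part of each [J i] of measure [min (b i) |J i|], then complete it to measure [b i] with
    pieces of the remaining set, whose measure is exactly what is missing. *)
Lemma leb_coupling n (b : nat -> R) (J : nat -> set R) :
  (forall i, 0 <= b i) -> \sum_(i < n) b i = 1 ->
  (forall i, Rborel (J i)) -> (forall i, J i `<=` I01) ->
  (forall i j, (i < n)%N -> (j < n)%N -> i != j -> J i `&` J j = set0) ->
  exists D : nat -> set R, [/\ forall i, Rborel (D i), forall i, D i `<=` I01,
    forall i, (i < n)%N -> leb (D i) = (b i)%:E,
    forall i j, (i < n)%N -> (j < n)%N -> i != j -> D i `&` D j = set0 &
    forall i, (i < n)%N -> ((Num.min (b i) (fine (leb (J i))))%:E <= leb (J i `&` D i))%E].
Proof.
move=> b0 b1 mJ JI tJ; pose m i := Num.min (b i) (fine (leb (J i))).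
have m0 i : 0 <= m i by rewrite le_min b0 fine_ge0 // measure_ge0.
have /choice [K hK] : forall i, exists K, [/\ Rborel K, K `<=` J i & leb K = (m i)%:E].
  by move=> i; apply: leb_split => //; rewrite -leb_fin // lee_fin ge_min lexx orbT.
have mK i : Rborel (K i) by case: (hK i).
have KJ i : K i `<=` J i by case: (hK i).
have lK i : leb (K i) = (m i)%:E by case: (hK i).
have tK i j : (i < n)%N -> (j < n)%N -> i != j -> K i `&` K j = set0.
  move=> ni nj ij; apply/seteqP; split=> x // [/KJ Ji /KJ Jj].
  suff : (J i `&` J j) x by rewrite tJ.
  by split.
pose U := \big[setU/set0]_(i < n) K i.
have mU : Rborel U by apply: bigsetU_measurable => i _; exact: mK.
have UI : U `<=` I01 by rewrite /U -bigcup_mkord => x [i _ /KJ /JI].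
have lU : leb U = (\sum_(i < n) m i)%:E.
  by rewrite leb_bigsetU // -sumEFin; apply: eq_bigr => i _; exact: lK.
have mW : Rborel (I01 `\` U) by apply: measurableD => //; exact: Rborel_I01.
have [i||E [mE EW lE tE]] := @leb_pieces n (fun i => b i - m i) _ mW (@subDsetl _ _ _).
- by rewrite subr_ge0 ge_min lexx.
- have : leb I01 = (leb U + leb (I01 `\` U))%E.
    by rewrite -leb_setU ?setDUK //; apply/seteqP; split=> x //= [? []].
  rewrite lU leb_I01 -(leb_fin mW (@subDsetl _ _ _)) -EFinD => -[]; rewrite lee_fin sumrB b1.
  by move=> ->; rewrite addrAC subrr add0r.
have KE i j : (i < n)%N -> K i `&` E j = set0.
  move=> ni; apply/seteqP; split=> x // [Kx /EW [_]]; apply.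
  by rewrite /U -bigcup_mkord; exists i.
exists (fun i => K i `|` E i); split=> [i|i|i ni|i j ni nj ij|i ni].
- by apply: measurableU; [exact: mK|exact: mE].
- by move=> x [/KJ /JI //|/EW []].
- by rewrite leb_setU ?KE // lK lE // -EFinD addrC subrK.
- by rewrite setIUr !setIUl tK // tE // KE // (setIC (E i)) KE // !setU0.
- apply: (@le_trans _ _ (leb (K i))); first by rewrite lK.
  apply: le_measure; rewrite ?inE //; first exact: mK.
    by apply: measurableI; [exact: mJ|apply: measurableU; [exact: mK|exact: mE]].
  by move=> x Kx; split; [exact: KJ|left].
Qed.

End Splitting.

(** A parameter [phi] of [V] is coupled with a parameter [psi] of [F] such that [phi = v k] and
    [psi = s k] hold together as often as possible. There distances agree exactly, and each [k]
    loses at most [e / (N + 1)]. *)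
Lemma box_finite (R : realType) (V F : mmspace R) N (s : 'I_N.+1 -> F) (v : 'I_N.+1 -> V) e :
  injective s -> (forall y, exists i, s i = y) ->
  (forall i j, mdist (v i) (v j) = mdist (s i) (s j)) ->
  (forall i, mmeas [set s i] - e / N.+1%:R <= mmeas [set v i]) ->
  0 <= e -> box V F <= e.
Proof.
move=> sI sS dv mv e0; apply: box_le => // -[phi [phib phim]] _.
pose t k := s (inord k).
have tI i j : (i < N.+1)%N -> (j < N.+1)%N -> i != j -> t i <> t j.
  move=> ni nj ij /sI /(congr1 val); rewrite /= !inordK // => eij.
  by rewrite eij eqxx in ij.
have vI i j : (i < N.+1)%N -> (j < N.+1)%N -> i != j -> v (inord i) <> v (inord j).
  move=> ni nj ij vij; apply: (tI _ _ ni nj ij).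
  by apply/dist_eq0; rewrite -dv vij distxx.
have mB (B : set F) : borel B ->
    mmeas B = \sum_(k < N.+1) (if `[< B (t k) >] then mmeas [set t k] else 0).
  move=> bB; pose G k := if (k < N.+1)%N && `[< B (t k) >] then [set t k] else set0.
  have bG k : borel (G k) by rewrite /G; case: ifP => _; [exact: borel1|exact: mborel0].
  have tG : trivIset setT G.
    apply/trivIsetP => i j _ _ ij; apply/seteqP; split=> x //; rewrite /G.
    move=> []; case: ifP => // /andP[ni _] /= ->; case: ifP => // /andP[nj _] /= tij.
    exact: (tI _ _ ni nj ij).
  rewrite (_ : mmeas B = mmeas (\big[setU/set0]_(k < N.+1) G k)).
    rewrite (mu_bigcup_ord _ bG tG); apply: eq_bigr => k _.
    by rewrite /G ltn_ord /=; case: ifP => // _; rewrite mu0.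
  congr mmeas; rewrite -bigcup_mkord; apply/seteqP; split=> y.
    move=> By; have [i iy] := sS y; exists (i : nat); first exact: ltn_ord.
    have ti : t i = y by rewrite /t inord_val.
    by rewrite /G ltn_ord ti asboolT.
  by move=> [i /= ni]; rewrite /G ni /=; case: asboolP => // Bi ->.
pose b k := mmeas [set t k].
have b0 k : 0 <= b k by apply: mu_ge0; exact: borel1.
have b1 : \sum_(k < N.+1) b k = 1.
  rewrite -(muT F) (mB _ (@mborelT _ _ _)); apply: eq_bigr => k _.
  by rewrite asboolT.
pose J k := @I01 R `&` phi @^-1` [set v (inord k)].
have mJ k : Rborel (J k) by apply: phib; exact: borel1.
have lJ k : leb (J k) = (mmeas [set v (inord k)])%:E by apply: phim; exact: borel1.
have JI k : J k `<=` @I01 R by move=> x [].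
have tJ i j : (i < N.+1)%N -> (j < N.+1)%N -> i != j -> J i `&` J j = set0.
  move=> ni nj ij; apply/seteqP; split=> x // [[_ /= vi] [_ /= vj]].
  by apply: (vI _ _ ni nj ij); rewrite -vi -vj.
have [D [mD DI lD tD hD]] := leb_coupling b0 b1 mJ JI tJ.
(* [psi] is [t k] on [D k], and the default [t 0] outside all of them, which on the unit interval
   means on the null set [W]. *)
have /choice [psi hpsi] : forall x, exists y, (forall k, (k < N.+1)%N -> D k x -> y = t k) /\
    ((forall k, (k < N.+1)%N -> ~ D k x) -> y = t 0%N).
  move=> x; have [[k nk Dk]|nD] := pselect (exists2 k, (k < N.+1)%N & D k x).
    exists (t k); split=> [j nj Dj|/(_ k nk)//]; have [->//|kj] := eqVneq k j.
    suff : (D k `&` D j) x by rewrite tD.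
    by split.
  by exists (t 0%N); split=> // k nk Dk; case: nD; exists k.
pose W := @I01 R `\` \big[setU/set0]_(k < N.+1) D k.
have mUD : Rborel (\big[setU/set0]_(k < N.+1) D k) by apply: bigsetU_measurable => i _; exact: mD.
have UDI : \big[setU/set0]_(k < N.+1) D k `<=` @I01 R.
  by rewrite -bigcup_mkord => x [k _ /DI].
have mW : Rborel W by apply: measurableD => //; exact: Rborel_I01.
have lW : leb W = 0%E.
  have : leb (@I01 R) = (leb (\big[setU/set0]_(k < N.+1) D k) + leb W)%E.
    by rewrite -leb_setU ?setDUK //; apply/seteqP; split=> x //= [? []].
  rewrite leb_bigsetU // (eq_bigr (fun k : 'I_N.+1 => (b k)%:E)); last first.
    by move=> k _; exact: lD.
  rewrite sumEFin b1 leb_I01 -(leb_fin mW (@subDsetl _ _ _)) -EFinD => -[] h.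
  by congr EFin; lra.
have psiE B : borel B -> let U := \big[setU/set0]_(k < N.+1)
      (if `[< B (t k) >] then D k else set0) in
    @I01 R `&` psi @^-1` B = U `|` (if `[< B (t 0%N) >] then W else set0) /\
    Rborel U /\ leb U = (mmeas B)%:E /\ U `&` (if `[< B (t 0%N) >] then W else set0) = set0.
  move=> bB U; pose G k := if `[< B (t k) >] then D k else set0.
  have mG k : Rborel (G k).
    by rewrite /G; case: ifP => // _; exact: (@measurable0 _ (measurableTypeR R)).
  split; [|split; [|split]].
  - apply/seteqP; split=> x.
      move=> [Ix /= Bx]; have [h1 h2] := hpsi x.
      have [[k nk Dk]|nD] := pselect (exists2 k, (k < N.+1)%N & D k x).
        left; rewrite /U -(@bigcup_mkord _ _ G).
        by exists k => //; rewrite /G asboolT // -(h1 k).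
      right; have h3 : forall k, (k < N.+1)%N -> ~ D k x by move=> k nk Dk; apply: nD; exists k.
      rewrite -h2 // asboolT //; split=> //; rewrite -bigcup_mkord => -[k nk /h3]; exact.
    case; last first.
      case: asboolP => // B0 [Ix nD]; split=> //=; have [h1 ->//] := hpsi x.
      by move=> k nk Dk; apply: nD; rewrite -bigcup_mkord; exists k.
    rewrite /U -(@bigcup_mkord _ _ G) => -[k /= nk]; rewrite /G; case: asboolP => // Bk Dk.
    by split; [exact: DI Dk|have [h1 _] := hpsi x; rewrite /= (h1 k)].
  - by apply: bigsetU_measurable => k _; exact: mG.
  - rewrite (@leb_bigsetU _ G) //.
      rewrite (mB _ bB) -sumEFin; apply: eq_bigr => k _; rewrite /G.
      by case: asboolP => // _; [exact: lD|rewrite /leb measure0].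
    move=> i j ni nj ij; rewrite /G; case: asboolP => _; case: asboolP => _;
      rewrite ?set0I ?setI0 //; exact: tD.
  - apply/seteqP; split=> x // []; rewrite /U -(@bigcup_mkord _ _ G) => -[k /= nk].
    rewrite /G; case: asboolP => // _ Dk; case: asboolP => // _ [_]; apply.
    by rewrite -bigcup_mkord; exists k.
exists phi, psi, (\big[setU/set0]_(k < N.+1) (J k `&` D k)).
have mJD k : Rborel (J k `&` D k) by apply: measurableI; [exact: mJ|exact: mD].
split.
- by [].
- split=> B bB; have [-> [mU [lU UW]]] := psiE B bB.
    by apply: measurableU => //; case: ifP => // _; exact: (@measurable0 _ (measurableTypeR R)).
  rewrite leb_setU // ?lU; first by case: ifP => _; rewrite ?lW /leb ?measure0 adde0.
  by case: ifP => // _; exact: (@measurable0 _ (measurableTypeR R)).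
- split; first by apply: bigsetU_measurable => i _; exact: mJD.
  by rewrite -(bigcup_mkord _ (fun k => J k `&` D k)) => x [k _ [/JI]].
- rewrite (@leb_bigsetU _ (fun k => J k `&` D k)) //; last first.
    by move=> i j ni nj ij; rewrite setIACA tD // setI0.
  apply: (@le_trans _ _ (\sum_(k < N.+1) (b k - e / N.+1%:R)%:E)%E).
    rewrite sumEFin lee_fin sumrB b1 sumr_const card_ord -[(e / _) *+ _]mulr_natr.
    by rewrite divfK // pnatr_eq0.
  apply: lee_sum => k _; apply: le_trans (hD k (ltn_ord k)).
  rewrite lee_fin lJ /= le_min gerBl divr_ge0 //=.
  by rewrite /b /t inord_val; exact: mv.
- move=> x y; rewrite -(bigcup_mkord _ (fun k => J k `&` D k)).
  move=> [k nk [[_ /= Jk] Dk]] [l nl [[_ /= Jl] Dl]].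
  have [hx _] := hpsi x; have [hy _] := hpsi y.
  by rewrite (hx k nk Dk) (hy l nl Dl) Jk Jl dv subrr normr0.
Qed.

(** * Collapsing far apart sets *)

Section SupMetric.
Variables (R : realType) (T : Type) (n : nat) (s : 'I_n -> T).
Hypothesis s_surj : forall p, exists j, s j = p.
Implicit Types u v : T -> R.

(** The sup norm distance on functions over a finite [T], finiteness being given by the enumeration
    [s]. *)
Definition sup_dist u v : R := \big[Num.max/0]_(j < n) `|u (s j) - v (s j)|.

Lemma sup_dist_le u v r : 0 <= r -> (forall p, `|u p - v p| <= r) -> sup_dist u v <= r.
Proof. by move=> r0 h; apply/bigmax_leP; split=> // j _; exact: h. Qed.

Lemma sup_dist_ge u v p : `|u p - v p| <= sup_dist u v.
Proof.
have [j <-] := s_surj p.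
exact: (le_bigmax _ (fun j => `|u (s j) - v (s j)|)).
Qed.

Lemma sup_dist_lt u v r : 0 < r -> (forall p, `|u p - v p| < r) -> sup_dist u v < r.
Proof. by move=> r0 h; apply/bigmax_ltP; split=> // j _; exact: h. Qed.

Lemma sup_dist_ge0 u v : 0 <= sup_dist u v.
Proof. exact: bigmax_ge_id. Qed.

Lemma sup_dist_metric : is_metric sup_dist.
Proof.
split=> [u v|u v|u v|u v w]; first exact: sup_dist_ge0.
- split=> [uv|->]; last first.
    apply/eqP; rewrite eq_le sup_dist_ge0 andbT; apply/sup_dist_le => // j.
    by rewrite subrr normr0.
  apply/funext => j; apply/eqP; rewrite -subr_eq0 -normr_eq0 eq_le normr_ge0 andbT.
  by rewrite -uv sup_dist_ge.
- by apply: eq_bigr => j _; rewrite distrC.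
- apply/sup_dist_le => [|j]; first by rewrite addr_ge0 ?sup_dist_ge0.
  apply: (le_trans (ler_distD (v j) _ _)).
  by apply: lerD; exact: sup_dist_ge.
Qed.

Lemma sup_dist_complete : mcomplete sup_dist.
Proof.
move=> u uC.
have cj j : exists l : R, forall e, 0 < e -> exists N, forall k, (N <= k)%N -> `|u k j - l| < e.
  have uc : cvg ((fun k => u k j) @ \oo).
    apply: R_complete; apply: cauchy_exP => e e0; have [N hN] := uC e e0.
    exists (u N j); exists N => // k /= Nk; rewrite /ball /= /ball_ /=.
    by apply: le_lt_trans (hN N k (leqnn N) Nk); exact: sup_dist_ge.
  exists (lim ((fun k => u k j) @ \oo)) => e e0.
  have /cvgrPdist_lt /(_ e e0) [N _ hN] := uc.
  by exists N => k Nk; rewrite distrC; exact: hN.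
have /choice [l hl] := cj.
exists l => e e0; have /choice [N hN] := fun j => hl j e e0.
exists (\max_(j < n) N (s j)) => k Nk; apply: sup_dist_lt => // p.
have [j <-] := s_surj p; apply: hN; apply: leq_trans Nk.
by rewrite (bigD1 j) //= leq_maxl.
Qed.

End SupMetric.

Section FarSets.
Variables (R : realType) (Y F : mmspace R) (N : nat) (s : 'I_N.+1 -> F).
Variables (A : 'I_N.+1 -> set Y) (L : R).
Hypotheses (s_surj : forall p, exists j, s j = p) (F_diam : forall p q : F, mdist p q <= L).
Hypothesis A_borel : forall i, borel (A i).
Hypothesis A_pos : forall i, 0 < mmeas (A i).
Hypothesis A_far : forall i j x y, i != j -> A i x -> A j y -> L <= mdist x y.

Let A_pt i : exists x, A i x.
Proof.
apply: contrapT => h; have := A_pos i; rewrite (_ : A i = set0) ?mu0 ?ltxx //.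
by apply/seteqP; split=> x // Ax; apply: h; exists x.
Qed.

Let E y p := [set r | exists i x, A i x /\ r = mdist (s i) p + mdist y x].

Let E_lb y p : lbound (E y p) 0.
Proof. by move=> _ [i [x [_ ->]]]; rewrite addr_ge0 ?dist_ge0. Qed.

Let f y p := inf (E y p).

(** A competitor [x] in another [A k] costs at least [mdist y x >= L], which already bounds
    [mdist (s i) p]. So the infimum is attained at [y] itself. *)
Let fA i y p : A i y -> f y p = mdist (s i) p.
Proof.
move=> Ay; apply/eqP; rewrite eq_le; apply/andP; split.
  apply: ge_inf; first by exists 0; exact: E_lb.
  by exists i, y; rewrite distxx addr0.
apply: lb_le_inf; first by exists (mdist (s i) p + mdist y y), i, y.
move=> _ [k [x [Ax ->]]]; have [<-|ik] := eqVneq i k; first by rewrite lerDl dist_ge0.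
apply: (le_trans (F_diam _ _)); apply: (le_trans (A_far ik Ay Ax)).
by rewrite lerDr dist_ge0.
Qed.

Let f_lip y y' p : f y p <= f y' p + mdist y y'.
Proof.
rewrite -lerBlDr; apply: lb_le_inf.
  by have [x Ax] := A_pt ord0; exists (mdist (s ord0) p + mdist y' x), ord0, x.
move=> _ [i [x [Ax ->]]]; rewrite lerBlDr.
apply: (@le_trans _ _ (mdist (s i) p + mdist y x)).
  apply: ge_inf; first by exists 0; exact: E_lb.
  by exists i, x.
by rewrite -addrA lerD2l addrC dist_tri.
Qed.

(* The map is McShane's extension, into the sup-normed space [F -> R], of the
   Kuratowski embedding of [F]: on [A i] it is constant because the sets are at
   mutual distance at least the diameter of [F].  The target cannot be
   ['I_N.+1 -> R], as the universe of ordinals exceeds that of carriers. *)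
Lemma collapse_far_sets : exists (V : mmspace R) (v : 'I_N.+1 -> V),
  [/\ dominated V Y, forall i j, mdist (v i) (v j) = mdist (s i) (s j) &
      forall i, mmeas (A i) <= mmeas [set v i]].
Proof.
have dm := sup_dist_metric R s_surj.
have f1 x y : sup_dist s (f x) (f y) <= 1 * mdist x y.
  rewrite mul1r; apply/sup_dist_le => [|p]; first exact: dist_ge0.
  have := f_lip x y p; have := f_lip y x p; rewrite (mdistC y x) ler_norml; lra.
have fb U : mopen (@sup_dist R F _ s) U -> borel (f @^-1` U).
  by move=> oU; apply: (mborel_lipschitz ltr01 f1); exact: mborel_open.
have fsep : exists u : nat -> Y, forall x e, 0 < e -> exists n, sup_dist s (f x) (f (u n)) < e.
  have [u uP] := mdist_separable Y; exists u => x e e0.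
  by have [n hn] := uP x e e0; exists n; apply: le_lt_trans hn; rewrite -[leRHS]mul1r.
have fsupp x r : 0 < r -> 0 < mmeas (f @^-1` mball (@sup_dist R F _ s) (f x) r).
  move=> r0; apply: lt_le_trans (mmeas_full_support x r0) _; apply: mu_le.
  - exact: borel_ball.
  - by apply: fb; exact: mopen_ball.
  - by move=> y xy; rewrite /mball /=; apply: le_lt_trans xy; rewrite -[leRHS]mul1r.
have [V [g [h [hg dV gb gm _]]]] := image_space dm
  (sup_dist_complete s_surj) fb fsep fsupp.
have /choice [a Aa] := A_pt.
have hinj x y : h x = h y -> x = y.
  by move=> xy; apply/dist_eq0; rewrite dV xy; case: dm => _ d0 _ _; exact/d0.
have fa i p : f (a i) p = mdist (s i) p by exact: fA.
exists V, (fun i => g (a i)); split=> [|i j|i].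
- exists g; split=> [x y|//]; by rewrite dV !hg -[leRHS]mul1r.
(* The Kuratowski embedding is isometric: the triangle inequality bounds the sup, and evaluation at
   [s j] attains it. *)
- rewrite dV !hg; apply/eqP; rewrite eq_le; apply/andP; split.
    apply/sup_dist_le => [|p]; first exact: dist_ge0.
    rewrite !fa ler_norml; have := dist_tri (s i) (s j) p.
    have := dist_tri (s j) (s i) p; rewrite (mdistC (s j) (s i)); lra.
  apply: le_trans (sup_dist_ge s_surj _ _ (s j)).
  by rewrite !fa distxx subr0 ger0_norm // dist_ge0.
- rewrite -gm; last exact: borel1.
  apply: mu_le => //; first by apply: gb; exact: borel1.
  move=> x Ax; apply: hinj; rewrite !hg; apply/funext => p.
  by rewrite fa; exact: fA.
Qed.

End FarSets.

(** * Separated sets of prescribed masses *)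

(** Since the capacities sum to 1 and the load is at most 1, some bin is always filled at most to
    capacity. Putting the next item there overshoots by at most [eta]. *)
Lemma greedy_bins (R : realType) N (b : 'I_N.+1 -> R) (m : nat -> R)
    (h0 : nat -> 'I_N.+1) K M (eta : R) :
  \sum_i b i = 1 -> \sum_(l < M) m l <= 1 -> (forall l, 0 <= m l) -> (K <= M)%N ->
  (forall i, \sum_(l < K | h0 l == i) m l <= b i + eta) ->
  (forall l, (K <= l < M)%N -> m l <= eta) ->
  exists h : nat -> 'I_N.+1, forall i, \sum_(l < M | h l == i) m l <= b i + eta.
Proof.
move=> b1 + m0; elim: M => [|M IH] m1 KM hK hM.
  by exists h0 => i; move: (hK i); move: KM; rewrite leqn0 => /eqP ->.
move: KM; rewrite leq_eqVlt => /orP[/eqP KM|KM]; first by exists h0 => i; rewrite -KM.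
rewrite big_ord_recr /= in m1.
have mM1 : \sum_(l < M) m l <= 1 by have := m0 M; lra.
have [|h hh] := IH mM1 KM hK.
  by move=> l /andP[Kl lM]; apply: hM; rewrite Kl ltnW.
have [i hi] : exists i, \sum_(l < M | h l == i) m l <= b i.
  apply: contrapT => ni.
  have : \sum_i b i < \sum_i \sum_(l < M | h l == i) m l.
    apply: ltr_sum => [|i _]; first by apply/hasP; exists ord0; rewrite ?mem_index_enum.
    by rewrite ltNge; apply/negP => le; apply: ni; exists i.
  have <- : \sum_(l < M) m l = \sum_i \sum_(l < M | h l == i) m l.
    exact: (partition_big (fun l : 'I_M => h l) xpredT).
  by rewrite b1 ltNge mM1.
exists (fun l => if l == M then i else h l) => j.
rewrite big_mkcond big_ord_recr /= eqxx.
rewrite (eq_bigr (fun l : 'I_M => if h l == j then m l else 0)); last first.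
  by move=> l _; rewrite ltn_eqF.
rewrite -big_mkcond /=; case: eqP => [<-|_]; last by rewrite addr0.
by apply: lerD => //; apply: hM; rewrite ltnSn andbT.
Qed.

Lemma atom_cases (R : realType) (Z : mmspace R) K (x : Z) :
  (exists2 j, (j < K)%N & atom Z j = x /\ 0 < atomw Z j) \/
  mmeas [set x] <= atomw Z K.
Proof.
have [x0|x0] := ltP 0 (mmeas [set x]); last first.
  by right; exact: le_trans x0 (atomw_ge0 _ _).
have [tx|ntx] := pselect (topset K x); last by right; exact: atomw_max.
left; elim: K tx => [//|K IH].
have [tx _|ntx] := pselect (topset K x).
  by have [j jK hj] := IH tx; exists j => //; exact: ltnW.
move=> [//|/= xE]; exists K => //; split=> //.
exact: lt_le_trans (atomw_max ntx).
Qed.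

Lemma sum_mu_points (R : realType) (F : mmspace R) N (s : 'I_N.+1 -> F) :
  injective s -> (forall p, exists i, s i = p) -> \sum_i mmeas [set s i] = 1.
Proof.
move=> s_inj s_surj.
have h := @mu_bigcup_ord R F (fun k => if (k < N.+1)%N then [set s (inord k)] else set0) N.+1.
rewrite (eq_bigr (fun i : 'I_N.+1 =>
    mmeas (if (i < N.+1)%N then [set s (inord i)] else set0))); last first.
  by move=> i _; rewrite ltn_ord inord_val.
rewrite -h.
- rewrite -(muT F) -(bigcup_mkord _ (fun k => if (k < N.+1)%N then [set s (inord k)] else set0)).
  congr mmeas; apply/seteqP; split=> p // _; have [i ip] := s_surj p.
  by exists (i : nat); rewrite /= ltn_ord // inord_val.
- by move=> i; case: ifP => _; [exact: borel1|exact: mborel0].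
- apply/trivIsetP => i j _ _ ij; apply/seteqP; split=> p // [].
  case: ifP => // ni /= ->; case: ifP => // nj /= /s_inj /(congr1 val) /=.
  by rewrite !inordK // => eij; rewrite eij eqxx in ij.
Qed.

Section SeparatedBins.
Variables (R : realType) (Z F : mmspace R) (N : nat) (s : 'I_N.+1 -> F).
Variables (a : nat -> R) (K : nat) (eta eps : R).
Hypotheses (s_inj : injective s) (s_surj : forall p, exists i, s i = p).
Hypotheses (a_ge0 : forall k, 0 <= a k) (aF : PA a F).
Hypotheses (eta_gt0 : 0 < eta) (eps_gt0 : 0 < eps).
Hypotheses (Keta : K.+1%:R^-1 < eta) (Keps : K%:R * (eps + eps) <= eta).
Hypothesis aZ : forall k, (k < K)%N -> atomw Z k <= a k + eps.

(** The first [K] balls surround the heaviest atoms, losing one [eps] in [aZ] and one in the radius.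
    The others have mass at most [eta] and centres in a dense sequence. Any point missed by the
    former is lighter than [eta] by [Keta], so it lies in one of the latter. *)
Let small_cover : exists (c : nat -> Z) (r : nat -> R),
  [/\ forall x, exists l, mdist (c l) x < r l,
      forall l, (l < K)%N -> mmeas (mball (@mdist _ Z) (c l) (r l)) <= a l + (eps + eps) &
      forall l, (K <= l)%N -> mmeas (mball (@mdist _ Z) (c l) (r l)) <= eta].
Proof.
have ball0 (x : Z) : mball (@mdist _ Z) x 0 = set0.
  by apply/seteqP; split=> y //; rewrite /mball /= ltNge dist_ge0.
have /choice [rho hrho] : forall l, exists r,
    mmeas (mball (@mdist _ Z) (atom Z l) r) <= atomw Z l + eps /\ (0 < atomw Z l -> 0 < r).
  move=> l; have [w0|w0] := ltP 0 (atomw Z l).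
    have [r r0 hr] := mu_ball_approx (atom Z l) eps_gt0; exists r; split=> //.
    by apply: le_trans (ltW hr) _; rewrite lerD2r; apply: atomw_max; exact: atomP.
  by exists 0; rewrite ball0 mu0 addr_ge0 ?atomw_ge0 // ltW.
have [q hq] := mdist_separable Z.
(* Pairs of a centre and a radius are enumerated by [pickle]; codes giving no light ball receive the
   empty ball of radius 0. *)
have /choice [cr hcr] : forall m, exists cr : Z * R,
    mmeas (mball (@mdist _ Z) cr.1 cr.2) <= eta /\
    (forall i j, unpickle m = Some (i, j) ->
       mmeas (mball (@mdist _ Z) (q i) j.+1%:R^-1) <= eta -> cr = (q i, j.+1%:R^-1)).
  move=> m; have [[i [j [mE h]]]|h] := pselect (exists i j : nat,
      unpickle m = Some (i, j) /\ mmeas (mball (@mdist _ Z) (q i) j.+1%:R^-1) <= eta).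
    by exists (q i, j.+1%:R^-1); split=> // i' j'; rewrite mE => -[<- <-].
  exists (q 0%N, 0); split; first by rewrite /= ball0 mu0 ltW.
  by move=> i j mE hij; case: h; exists i, j.
exists (fun l => if (l < K)%N then atom Z l else (cr (l - K)%N).1).
exists (fun l => if (l < K)%N then rho l else (cr (l - K)%N).2); split.
- move=> x; have [[j jK [jx j0]]|hx] := atom_cases K x.
    by exists j; rewrite jK -jx distxx; apply: (hrho j).2.
  have xeta : 0 < eta - mmeas [set x].
    rewrite subr_gt0; apply: le_lt_trans hx (le_lt_trans (atomw_small _ _) Keta).
  have [r r0 hr] := mu_ball_approx x xeta.
  have r2 : 0 < r / 2 by rewrite divr_gt0.
  have [j hj] := ltr_add_invr r2; rewrite add0r in hj.
  have [i hi] := hq x j.+1%:R^-1 (ltac:(by rewrite invr_gt0 ltr0n)).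
  exists (K + pickle (i, j))%N; rewrite ltnNge leq_addr /= addKn.
  have [_ /(_ i j (pickleK _)) ->] := hcr (pickle (i, j)); first by rewrite mdistC.
  apply: le_trans (_ : mmeas (mball (@mdist _ Z) x r) <= _); last lra.
  apply: mu_le; [exact: borel_ball|exact: borel_ball|] => y; rewrite /mball /= => qy.
  have := dist_tri (q i) x y; move: hi qy hj; set t := j.+1%:R^-1; lra.
- move=> l lK; rewrite lK; have [h _] := hrho l; apply: (le_trans h).
  by rewrite addrA lerD2r aZ.
- by move=> l Kl; rewrite ltnNge Kl /=; case: (hcr (l - K)%N).
Qed.

(* The cells of [first_ball] become uniformly separated once every radius is
   shrunk by a small amount. *)
Lemma separated_bins : exists (A : 'I_N.+1 -> set Z) (rho : R),
  [/\ 0 < rho, forall i, borel (A i),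
      forall i, mmeas [set s i] - N.+1%:R * eta <= mmeas (A i) &
      forall i j x y, i != j -> A i x -> A j y -> rho <= mdist x y].
Proof.
have [c [r [hcov hK hM]]] := small_cover.
have [M0 hM0] := first_ball_cover eta_gt0 hcov.
pose M := maxn M0 K; have {hM0} hcovM := hM0 M (leq_maxl _ _).
have KM : (K <= M)%N by exact: leq_maxr.
set g := first_ball c r M in hcovM *.
have bg l : borel (g @^-1` [set l]) by exact: borel_first_ball.
pose m l := mmeas (g @^-1` [set l]).
have m0 l : 0 <= m l by exact: mu_ge0.
have bsF := sum_mu_points s_inj s_surj.
have msum : \sum_(l < M.+1) m l = 1.
  rewrite -(mu_fibre xpredT _ bg) -(muT Z); congr mmeas; apply/seteqP; split=> x //= _.
  by rewrite andbT ltnS; exact: first_ball_le.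
have mball_le l : (l < M)%N -> m l <= mmeas (mball (@mdist _ Z) (c l) (r l)).
  move=> lM; apply: mu_le => //; first exact: borel_ball.
  by move=> x /= gx; rewrite /mball /= -gx; apply: first_ball_lt; rewrite -/g gx.
have [x hx] := aF.
have /choice [h0 hh0] := fun k => s_surj (x k).
(* The cell of the [l]-th heavy atom goes to the point [x l] prescribed by [aF]. The total excess is
   at most [K * (eps + eps)], which [Keps] bounds by [eta]. *)
have bins0 i : \sum_(l < K | h0 l == i) m l <= mmeas [set s i] + eta.
  apply: (@le_trans _ _ (\sum_(l < K | h0 l == i) (a l + (eps + eps)))).
    apply: ler_sum => l _; apply: le_trans (hK l (ltn_ord l)).
    by apply: mball_le; exact: leq_trans (ltn_ord l) KM.
  rewrite big_split /=; apply: lerD.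
    have ha l : 0 <= a l * \1_[set s i] (x l) by rewrite mulr_ge0.
    apply: le_trans (nneseries_ge_partial ha (hx _ (borel1 _)) K).
    rewrite big_mkcond /=; apply: ler_sum => l _; case: eqP => [<-|_] //.
    by rewrite hh0 indicE mem_set // mulr1.
  apply: le_trans Keps; rewrite sumr_const -[leLHS]mulr_natl.
  apply: ler_wpM2r; first by rewrite addr_ge0 // ltW.
  by rewrite ler_nat -[leqRHS](card_ord K) max_card.
have msum1 : \sum_(l < M.+1) m l <= 1 by rewrite msum.
(* There are [M + 1] items because the leftover cell [M] is distributed too; its mass is below [eta]
   by [hcovM]. *)
have [|h hh] := greedy_bins bsF msum1 m0 (leqW KM) bins0.
  move=> l /andP[Kl]; rewrite ltnS leq_eqVlt => /orP[/eqP ->|lM]; last first.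
    exact: le_trans (mball_le _ lM) (hM _ Kl).
  have E : mmeas [set y | (g y < M)%N] = \sum_(l < M) m l.
    rewrite -(mu_fibre xpredT M bg); congr mmeas.
    by apply/seteqP; split=> y /=; rewrite andbT.
  by move: msum hcovM; rewrite big_ord_recr /= E; lra.
pose C i := [set y | h (g y) = i].
have bC i : borel (C i) by exact: (borel_fibre (fun l => h l = i)).
have muC_le i : mmeas (C i) <= mmeas [set s i] + eta.
  rewrite (_ : C i = [set y | (g y < M.+1)%N && (h (g y) == i)]).
    by rewrite (mu_fibre (fun l => h l == i) _ bg); exact: hh.
  apply/seteqP; split=> y /=; last by move=> /andP[_ /eqP].
  by move=> <-; rewrite eqxx andbT ltnS; exact: first_ball_le.
(* The masses total 1 and each of the [N] other bins exceeds its target by at most [eta]. *)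
have muC_ge i : mmeas [set s i] - N%:R * eta <= mmeas (C i).
  have sC : \sum_i mmeas (C i) = 1.
    rewrite -msum (partition_big (fun l : 'I_M.+1 => h l) xpredT) //=.
    apply: eq_bigr => k _; rewrite -(mu_fibre (fun l => h l == k) _ bg).
    congr mmeas; apply/seteqP; split=> y /=; last by move=> /andP[_ /eqP].
    by move=> <-; rewrite eqxx andbT ltnS; exact: first_ball_le.
  have sb := bsF; rewrite (bigD1 i) //= in sC; rewrite (bigD1 i) //= in sb.
  have : \sum_(j < N.+1 | j != i) mmeas (C j) <=
         \sum_(j < N.+1 | j != i) (mmeas [set s j] + eta) by exact: ler_sum.
  rewrite big_split /= sumr_const.
  rewrite (_ : #|[pred j | j != i]| = N); last by rewrite cardC1 card_ord.
  by rewrite -mulr_natl; lra.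
(* The points at depth at least [1 / (n + 1)] in their first ball, together with the whole leftover
   cell. These sets exhaust [Z], so passing to one of them costs less than one more [eta]. *)
pose D n := [set y | g y = M \/ mdist (c (g y)) y <= r (g y) - n.+1%:R^-1].
have bD n : borel (D n).
  rewrite (_ : D n = \bigcup_l (g @^-1` [set l] `&`
      ([set _ | l = M] `|` [set y | mdist (c l) y <= r l - n.+1%:R^-1]))).
    apply: mborel_bigcup => l; apply: mborelI; first exact: bg.
    apply: mborelU; first exact: mborel_const.
    by apply: mborel_le; exact: mdist_metric.
  by apply/seteqP; split=> y /= => [hy|[l _ [gl]]]; [exists (g y)|rewrite -gl].
have sD n : D n `<=` D n.+1.
  move=> y [gM|hy]; [by left|right]; apply: le_trans hy _; rewrite lerB //.
  by rewrite lef_pV2 ?posrE ?ltr0n // ler_nat.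
have [n hn] := mu_bigcup_approx bD sD eta_gt0.
have DT : \bigcup_n D n = setT.
  apply/seteqP; split=> y // _; have [gM|gM] := eqVneq (g y) M; first by exists 0%N => //; left.
  have : 0 < r (g y) - mdist (c (g y)) y.
    rewrite subr_gt0; apply: first_ball_lt; rewrite -/g.
    by rewrite ltn_neqAle gM first_ball_le.
  by move=> /ltr_add_invr[k]; rewrite add0r => hk; exists k => //; right;
    rewrite lerBrDl -lerBrDr ltW.
rewrite DT muT in hn.
exists (fun i => C i `&` D n), n.+1%:R^-1; split.
- by rewrite invr_gt0 ltr0n.
- by move=> i; apply: mborelI; [exact: bC|exact: bD].
- move=> i; have bCD : borel (C i `&` D n) by apply: mborelI; [exact: bC|exact: bD].
  have := @mu_inclU _ Z (C i) (C i `&` D n) (~` D n) (bC i) bCD (mborelC (bD n)).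
  rewrite muC // => h1; have {}h1 : mmeas (C i) <= mmeas (C i `&` D n) + (1 - mmeas (D n)).
    by apply: h1 => y Cy; have [Dy|nDy] := pselect (D n y); [left|right].
  by have := muC_ge i; rewrite -natr1 mulrDl mul1r; lra.
(* A point [z] of a later cell is outside the ball of [g y], in which [y] lies at depth at least
   [1 / (n + 1)]. *)
- have sep y z : (g y < g z)%N -> D n y -> n.+1%:R^-1 <= mdist y z.
    move=> gyz [gM|hy]; first by move: gyz; rewrite gM ltnNge first_ball_le.
    have := first_ball_ge gyz; have := dist_tri y (c (g y)) z.
    by move: hy; set t := n.+1%:R^-1; lra.
  move=> i j y z ij [Cy Dy] [Cz Dz].
  have [yz|zy|E] := ltngtP (g y) (g z); [exact: sep|by rewrite mdistC; exact: sep|].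
  by move: ij; rewrite -Cy -Cz E eqxx.
Qed.

End SeparatedBins.

(** * Scale-invariant pyramids *)

Lemma finite_enum (T : Type) (s : nat -> T) M : exists N (s' : 'I_N.+1 -> T),
  injective s' /\ forall l, (l <= M)%N -> exists i, s' i = s l.
Proof.
elim: M => [|M [N [s' [sI sS]]]].
  exists 0%N, (fun=> s 0%N); split=> [i j _|l]; first by rewrite !ord1.
  by rewrite leqn0 => /eqP ->; exists ord0.
have [[i iM]|nM] := pselect (exists i, s' i = s M.+1).
  exists N, s'; split=> // l; rewrite leq_eqVlt => /orP[/eqP ->|]; first by exists i.
  exact: sS.
exists N.+1, (fun i => if unlift ord_max i is Some j then s' j else s M.+1); split.
  move=> i j; case: unliftP => [i' ->|->]; case: unliftP => [j' ->|->] //.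
  - by move=> /sI ->.
  - by move=> h; case: nM; exists i'.
  - by move=> h; case: nM; exists j'.
move=> l; rewrite leq_eqVlt => /orP[/eqP ->|lM].
  by exists ord_max; rewrite unlift_none.
by have [i <-] := sS l lM; exists (lift ord_max i); rewrite liftK.
Qed.

Section Pyramid.
Variables (R : realType) (P : set (mmspace R)).
Hypothesis hP : pyramid P.

Lemma pyramid_box_closed X :
  (forall e, 0 < e -> exists2 V, P V & box V X <= e) -> P X.
Proof.
move=> h; have inv0 n : 0 < n.+1%:R^-1 :> R by rewrite invr_gt0 ltr0n.
have /choice [V hV] : forall n, exists V, P V /\ box V X <= n.+1%:R^-1.
  by move=> n; have [V PV bV] := h _ (inv0 n); exists V.
have [_ cl _ _] := hP; apply: (cl V X) => [n|]; first by case: (hV n).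
apply/cvgrPdist_lt => e e0; near=> n.
rewrite sub0r normrN ger0_norm ?box_ge0 //; apply: le_lt_trans (hV n).2 _.
near: n; exact: (near_infty_natSinv_lt (PosNum e0)).
Unshelve. all: by end_near. Qed.

Section Finite.
Variables (F : mmspace R) (N : nat) (s : 'I_N.+1 -> F).
Hypotheses (s_inj : injective s) (s_surj : forall p, exists i, s i = p).
Hypothesis aF : PA (pyr_atomw P) F.

Local Notation b i := (mmeas [set s i]).

(** The minimal distance from [s i] to the other points is the radius of a ball reduced to [s i], so
    full support applies. *)
Lemma mu_point_gt0 i : 0 < b i.
Proof.
pose r := \big[Num.min/1]_(j < N.+1 | j != i) mdist (s i) (s j).
have r0 : 0 < r.
  apply/bigmin_gtP; split=> // j ji; rewrite lt_neqAle dist_ge0 andbT.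
  by apply/eqP => /esym/dist_eq0/s_inj ij; rewrite ij eqxx in ji.
apply: lt_le_trans (mmeas_full_support (s i) r0) _.
apply: mu_le; [exact: borel_ball|exact: borel1|] => p; have [j <-] := s_surj p.
have [->//|ji] := eqVneq j i; rewrite /mball /= ltNge.
by rewrite /r bigmin_le_cond.
Qed.

Hypothesis sep0y : forall kappa : 'I_N.+1 -> R, (forall i, 0 < kappa i) ->
  \sum_i kappa i < 1 -> Sep_pyr P kappa = 0%E \/ Sep_pyr P kappa = +oo%E.

(** The bins found in one [Z] of [P] make the separation distance at masses [b i - r] positive,
    hence infinite. Some [Y] in [P] then has sets more than [L] apart. *)
Lemma far_sets L e : 0 <= L -> 0 < e -> exists (Y : mmspace R) (A : 'I_N.+1 -> set Y),
  [/\ P Y, forall i, borel (A i), forall i, 0 < mmeas (A i),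
      forall i, b i - e <= mmeas (A i) &
      forall i j x y, i != j -> A i x -> A j y -> L <= mdist x y].
Proof.
(* The mass [r] is lost twice, in [kappa] and as [delta]. The bound [e / 2] keeps the loss within
   [e], and [b i / 4] keeps the masses positive. *)
move=> L0 e0; pose r := \big[Num.min/e / 2]_i (b i / 4).
have r0 : 0 < r.
  apply/bigmin_gtP; split=> [|i _]; first by rewrite divr_gt0.
  by rewrite divr_gt0 ?mu_point_gt0.
have re : r <= e / 2 by exact: bigmin_le_id.
have rb i : r <= b i / 4 by exact: bigmin_le_cond.
(* With this [eta], the loss [(N + 1) * eta] in [separated_bins] is exactly [r]. *)
pose eta := r / N.+1%:R; have eta0 : 0 < eta by rewrite divr_gt0 ?ltr0n.
have [K hK] := ltr_add_invr eta0; rewrite add0r in hK.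
pose eps := eta / (2 * K.+1%:R).
have eps0 : 0 < eps by rewrite divr_gt0 // mulr_gt0 ?ltr0n.
have Keps : K%:R * (eps + eps) <= eta.
  have -> : eps + eps = eta / K.+1%:R.
    have : K.+1%:R != 0 :> R by rewrite pnatr_eq0.
    by rewrite /eps; set k := K.+1%:R => k0; field.
  by rewrite mulrA ler_pdivrMr ?ltr0n // mulrC ler_wpM2l ?ler_nat // ltW.
have [[X PX] _ _ _] := hP.
have [Z [PZ _ hZ]] := pyr_atomw_approx hP K PX eps0.
have [a0 _ _] := seqA_pyr_atomw hP.
have [|A [rho [rho0 bA mA sA]]] :=
  separated_bins s_inj s_surj a0 aF eta0 eps0 hK Keps (Z := Z).
  by move=> k /hZ; rewrite ltr_norml => /andP[_]; rewrite ltrBlDl => /ltW; rewrite addrC.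
have eN : N.+1%:R * eta = r by rewrite /eta mulrC divfK // pnatr_eq0.
pose kappa i := b i - r.
have k0 i : 0 < kappa i by have := rb i; have := mu_point_gt0 i; rewrite /kappa; lra.
have k1 i : kappa i <= 1.
  by have := mu_le1 (borel1 (s i)); rewrite /kappa; lra.
have ksum : \sum_i kappa i < 1.
  by rewrite sumrB (sum_mu_points s_inj s_surj) sumr_const card_ord ltrBlDr ltrDl mulrn_wgt0.
have SZ : (rho%:E <= Sep_mm Z kappa)%E.
  rewrite /Sep_mm asboolF => [|[i]]; last by rewrite ltNge k1.
  apply: le_ereal_sup_tmp.
  exists (ereal_inf [set s | exists i j, i != j /\ s = set_dist (A i) (A j)]).
    by exists A => // i; split=> //; have := mA i; rewrite eN.
  apply: le_ereal_inf_tmp => _ [i [j [ij ->]]].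
  by apply: le_ereal_inf_tmp => _ [x Ax [y Ay <-]]; rewrite lee_fin; exact: sA ij Ax Ay.
have [S0|Sy] := sep0y k0 ksum.
  have : (rho%:E <= Sep_pyr P kappa)%E.
    rewrite Sep_pyrE; apply: le_ereal_inf_tmp => _ [d /= d0 <-]; apply: (le_trans SZ).
    have SZd : (Sep_mm Z kappa <= Sep_mm Z (fun i => kappa i - d)%R)%E.
      by apply: Sep_mm_anti => i; rewrite gerBl ltW.
    by apply: (le_trans SZd); apply: ereal_sup_ubound; exists Z.
  by rewrite S0 lee_fin leNgt rho0.
move: Sy; rewrite Sep_pyrE => /ereal_inf_pinfty /(_ (Sep_pyr_delta P kappa r)) /= Sr.
have : (L%:E < Sep_pyr_delta P kappa r)%E by rewrite Sr ?ltry //; exists r.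
move=> /ereal_sup_gt [_ [Y PY <-]]; rewrite /Sep_mm; case: asboolP => _.
  by rewrite lte_fin ltNge L0.
move=> /ereal_sup_gt [_ [B hB <-]] LB; exists Y, B.
have mB i : kappa i - r <= mmeas (B i) by case: (hB i).
split=> // [i|i|i|i j x y ij Bx By]; first by case: (hB i).
- by have := mB i; have := rb i; have := mu_point_gt0 i; rewrite /kappa; lra.
- by have := mB i; rewrite /kappa; lra.
- rewrite -lee_fin ltW //; apply: lt_le_trans LB _.
  apply: ge_ereal_inf; exists (set_dist (B i) (B j)); first by exists i, j.
  by apply: ge_ereal_inf; exists (mdist x y)%:E => //; exists x => //; exists y.
Qed.

Lemma finite_in_pyramid : P F.
Proof.
apply: pyramid_box_closed => e e0.
pose L := \big[Num.max/0]_i \big[Num.max/0]_j mdist (s i) (s j).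
have L0 : 0 <= L by exact: bigmax_ge_id.
have FL (p q : F) : mdist p q <= L.
  have [i <-] := s_surj p; have [j <-] := s_surj q.
  apply: le_trans (le_bigmax _ (fun i => \big[Num.max/0]_j mdist (s i) (s j)) i).
  exact: (le_bigmax _ (fun j => mdist (s i) (s j)) j).
have eN : 0 < e / N.+1%:R by rewrite divr_gt0 ?ltr0n.
have [Y [A [PY bA A0 mA sA]]] := far_sets L0 eN.
have [V [v [VY dv mv]]] := collapse_far_sets s_surj FL bA A0 sA.
have [_ _ down _] := hP; exists V; first exact: down PY VY.
apply: (box_finite s_inj s_surj dv) => [i|]; last exact: ltW.
exact: le_trans (mA i) (mv i).
Qed.

End Finite.

Lemma PA_sub_pyramid :
  (forall (N : nat) (kappa : 'I_N.+1 -> R), (1 <= N)%N -> (forall i, 0 < kappa i) ->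
     \sum_(i < N.+1) kappa i < 1 -> Sep_pyr P kappa = 0%:E \/ Sep_pyr P kappa = +oo%E) ->
  PA (pyr_atomw P) `<=` P.
Proof.
move=> sep X aX; apply: pyramid_box_closed => e e0.
have [F [bF aF [M [s hs]]]] := finite_approx X e0.
exists F => //; have [[|N] [s' [sI sS]]] := finite_enum s M; last first.
  apply: (@finite_in_pyramid F N.+1 s' sI _ (aF _ aX)) => [p|kappa]; last exact: sep.
  by have [l lM <-] := hs p; exact: sS.
(* Here [N = 0], outside the range of [sep]: [F] is a single point, dominated by any space through a
   constant map. *)
have F1 (p q : F) : p = q.
  have [l lM <-] := hs p; have [k kM <-] := hs q.
  by have [i <-] := sS l lM; have [j <-] := sS k kM; rewrite !ord1.
have [[Y PY] _ down _] := hP; apply: down PY _; exists (fun=> s 0%N); split=> [x x'|B bB].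
  by rewrite distxx dist_ge0.
have [Bs|nBs] := pselect (B (s 0%N)).
  have -> : B = setT by apply/seteqP; split=> p // _; rewrite (F1 p (s 0%N)).
  by rewrite preimage_setT !muT.
have -> : B = set0 by apply/seteqP; split=> p // Bp; apply: nBs; rewrite (F1 (s 0%N) p).
by rewrite preimage_set0 !mu0.
Qed.

End Pyramid.

Theorem theorem1p5 (R : realType) (P : set (mmspace R)) :
  pyramid P ->
  (fixed_pyr P <-> exists2 t : R, 0 < t & t != 1 /\ scale_pyr t P = P) /\
  (fixed_pyr P <->
     forall (N : nat) (kappa : 'I_N.+1 -> R),
       (1 <= N)%N -> (forall i, 0 < kappa i) -> \sum_(i < N.+1) kappa i < 1 ->
       Sep_pyr P kappa = 0%:E \/ Sep_pyr P kappa = +oo%E) /\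
  (fixed_pyr P <-> exists2 a : nat -> R, seqA a & P = PA a).
Proof.
move=> hP; have [PX _ _ _] := hP.
set fixed := fixed_pyr P; set inv := exists2 t, _ & _; set sep := forall N, _.
set discrete := exists2 a, _ & _.
(* The four implications form a cycle, which yields all the equivalences. *)
have fixed_inv : fixed -> inv.
  by move=> fP; exists 2; rewrite ?pnatr_eq1 //; split=> //; exact: fP.
have inv_sep : inv -> sep.
  by move=> [t t0 [t1 tP]] N kappa _ _ _; exact: scale_invariant_Sep tP.
have sep_discrete : sep -> discrete.
  move=> h; exists (pyr_atomw P); first exact: seqA_pyr_atomw.
  by apply/seteqP; split; [exact: pyramid_sub_PA|exact: PA_sub_pyramid].
have discrete_fixed : discrete -> fixed.
  by move=> [a _ Pa]; rewrite /fixed Pa; exact: fixed_PA.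
by tauto.
Qed.
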